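(* Let $G$ be the free product of at most countably many countably infinite abelian groups. Then for every $\alpha \in \mathit{FR}(G,X,\mu)$, the orbit equivalence class $[\alpha]_{\mathit{OE}}$ is dense in $A(G,X,\mu)$ with respect to the weak topology.
   Context: $(X,\mu)$ is a non-atomic standard probability space. $\mathrm{Aut}(X,\mu)$ is the group of measure-preserving Borel automorphisms of $(X,\mu)$, identified when they agree $\mu$-a.e. Its weak topology is generated by the sets $\{R \in \mathrm{Aut}(X,\mu) : \mu(R(P)\,\triangle\, S(P))<\varepsilon \text{ for all } P\in\mathcal P\}$, where $S\in\mathrm{Aut}(X,\mu)$, $\varepsilon>0$ and $\mathcal P$ is a finite Borel partition of $X$. For a countable group $G$, $A(G,X,\mu)$ is the set of homomorphisms $\alpha: G\to \mathrm{Aut}(X,\mu)$ (p.m.p. actions); write $g^\alpha=\alpha(g)$. It carries the subspace topology of $\prod_G \mathrm{Aut}(X,\mu)$ with the product of weak topologies. $\mathit{FR}(G,X,\mu)\subset A(G,X,\mu)$ is the set of essentially free actions. Two actions $\alpha,\beta\in A(G,X,\mu)$ are orbit equivalent if there is $R\in\mathrm{Aut}(X,\mu)$ with $G^\alpha x = R G^\beta R^{-1}x$ for $\mu$-a.e. $x$; $[\alpha]_{\mathit{OE}}$ is the set of actions in $A(G,X,\mu)$ orbit equivalent to $\alpha$. *)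

(* Defs.v *)
From HB Require Import structures.
From mathcomp Require Import all_boot all_order all_algebra.
From mathcomp Require Import all_classical all_reals all_analysis.
Set Implicit Arguments. Unset Strict Implicit. Unset Printing Implicit Defensive.
Import Order.TTheory GRing.Theory Num.Theory.
Local Open Scope classical_set_scope.
Local Open Scope ring_scope.

Record group := Group {
  gcar :> Type;
  gmul : gcar -> gcar -> gcar;
  ginv : gcar -> gcar;
  gone : gcar;
  gmulA : forall x y z, gmul x (gmul y z) = gmul (gmul x y) z;
  gmul1 : forall x, gmul gone x = x;
  gmulV : forall x, gmul (ginv x) x = gone }.

Definition is_hom (G H : group) (f : G -> H) : Prop :=
  forall x y : G, f (gmul x y) = gmul (f x) (f y).

Definition abelian_group (G : group) : Prop :=
  forall x y : G, gmul x y = gmul y x.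

Definition countably_infinite (T : Type) : Prop :=
  exists f : nat -> T, bijective f.

Definition at_most_countable (T : Type) : Prop :=
  exists f : T -> nat, injective f.

Definition free_product (I : Type) (A : I -> group) (G : group)
    (iota : forall i, A i -> G) : Prop :=
  (forall i, is_hom (iota i)) /\
  forall (H : group) (phi : forall i, A i -> H),
    (forall i, is_hom (phi i)) ->
    exists psi : G -> H,
      [/\ is_hom psi, (forall i (a : A i), psi (iota i a) = phi i a) &
          forall psi' : G -> H, is_hom psi' ->
            (forall i (a : A i), psi' (iota i a) = phi i a) ->
            forall g, psi' g = psi g].

Section Meas.
Context (R : realType) (d : measure_display) (X : measurableType d).

Definition standard_borel : Prop :=
  exists (B : set R) (f : X -> R),
    [/\ measurable B, measurable_fun setT f, injective f, f @` setT = B &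
        forall A : set X, measurable A -> measurable (f @` A)].

Variable mu : probability X R.

Definition nonatomic : Prop :=
  forall A : set X, measurable A -> (0 < mu A)%E ->
    exists B : set X, [/\ measurable B, B `<=` A, (0 < mu B)%E & (mu B < mu A)%E].

Definition ae_prop (P : X -> Prop) : Prop :=
  exists N : set X, [/\ measurable N, mu N = 0%E & forall x, ~ N x -> P x].

Definition mp_aut_pair (T Tinv : X -> X) : Prop :=
  [/\ measurable_fun setT T, measurable_fun setT Tinv,
      cancel T Tinv, cancel Tinv T &
      forall A : set X, measurable A -> mu (T @^-1` A) = mu A].

Definition mp_aut (T : X -> X) : Prop := exists Tinv, mp_aut_pair T Tinv.

Variable G : group.

(* a : G -> X -> X represents an element of A(G,X,mu): each a g is in
   Aut(X,mu) and g |-> [a g] is a homomorphism into Aut(X,mu)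
   (automorphisms identified when equal a.e.). *)
Definition pmp_action (a : G -> X -> X) : Prop :=
  (forall g, mp_aut (a g)) /\
  forall g h : G, ae_prop (fun x => a (gmul g h) x = a g (a h x)).

Definition ess_free (a : G -> X -> X) : Prop :=
  ae_prop (fun x => forall g : G, g <> gone G -> a g x <> x).

Definition orbit_equiv (a b : G -> X -> X) : Prop :=
  exists T Tinv : X -> X, mp_aut_pair T Tinv /\
    ae_prop (fun x => [set y | exists g : G, y = a g x] =
                      [set y | exists h : G, y = T (b h (Tinv x))]).

Definition OE_class (a : G -> X -> X) : (G -> X -> X) -> Prop :=
  fun b => pmp_action b /\ orbit_equiv b a.

Definition borel_partition (m : nat) (P : nat -> set X) : Prop :=
  [/\ forall j, (j < m)%N -> measurable (P j),
      forall i j, (i < m)%N -> (j < m)%N -> i <> j -> P i `&` P j = set0 &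
      forall x, exists2 j, (j < m)%N & P j x].

Definition symdiff (A B : set X) : set X := (A `\` B) `|` (B `\` A).

Definition weak_subbasic (S : X -> X) (eps : R) (m : nat) (P : nat -> set X)
    (T : X -> X) : Prop :=
  forall j, (j < m)%N -> (mu (symdiff (T @` P j) (S @` P j)) < eps%:E)%E.

(* A set C of actions is dense in A(G,X,mu) for the product of the weak
   topologies: it meets every nonempty basic open set, i.e. every finite
   intersection of subbasic sets { a : a (g k) in weak_subbasic ... }. *)
Definition dense_in_actions (C : (G -> X -> X) -> Prop) : Prop :=
  forall (n : nat) (g : nat -> G) (S : nat -> X -> X) (eps : nat -> R)
         (m : nat -> nat) (P : nat -> nat -> set X),
    (forall k, (k < n)%N ->
       [/\ mp_aut (S k), 0 < eps k & borel_partition (m k) (P k)]) ->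
    (exists b, pmp_action b /\
       forall k, (k < n)%N -> weak_subbasic (S k) (eps k) (m k) (P k) (b (g k))) ->
    exists a, C a /\ pmp_action a /\
       forall k, (k < n)%N -> weak_subbasic (S k) (eps k) (m k) (P k) (a (g k)).

End Meas.

(* Main.v *)
(* The actions [alpha_i] of the free factors [A_i] are free actions of infinite
   abelian groups.  Let [b] be an action to be approximated and [P] a finite
   partition which records the relevant sets and their images under [b].  A random
   partition [Q] is nearly equidistributed along the orbits of each of the finitely
   many relevant [alpha_i], and since [X] carries an ergodic action of a countable
   group, some automorphism [T] carries [Q] to [P] up to a small error.  For each
   [i], amenability of [A_i] gives a map [phi_i : X -> X] which is approximately
   equivariant from [alpha_i] to [b] and for which the pulled back partition
   [P o phi_i] is also nearly equidistributed along the orbits of [alpha_i].  As [Q]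
   and [P o phi_i] have nearly the same frequencies on every invariant set, some
   [R_i] in the full group of [alpha_i] carries one to the other up to a small
   error.  Conjugating [alpha_i] by [T R_i] yields an action of [A_i] close to [b],
   and the resulting action of the free product has the orbits of [alpha]
   transported by [T], because [R_i] preserves every orbit of [alpha_i]. *)

Require Import Defs.
From HB Require Import structures.
From mathcomp Require Import all_boot all_order all_algebra.
From mathcomp Require Import all_classical all_reals all_analysis.
From mathcomp Require Import perm measurable_realfun ring lra.

Set Implicit Arguments.
Unset Strict Implicit.
Unset Printing Implicit Defensive.
Import Order.TTheory GRing.Theory Num.Theory.
Local Open Scope classical_set_scope.
Local Open Scope ring_scope.

(** The conjugations keep the orbits only because those of different factors share [T] and differ
    from it by elements of the full groups of the [alpha_i]; hence a single partition [Q] must serve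
    all relevant factors at once. An [alpha_i] need not be ergodic, so an element of its full group
    can match two partitions only if their frequencies agree on every invariant set, not just on
    [X]; this obstacle shapes the construction. The agreement comes from a second moment estimate:
    infinite orbits supply as many distinct sample points as desired, the average of many
    independent samples is nearly constant, and averaging over translates does not change the
    measure of a set inside an invariant set. Randomness is kept finite: the cells of a fine
    partition receive independent samples from a finite set, and an outcome that suits all
    requirements exists by averaging. Of [phi_i] only the pulled back partition has to be
    measurable. The actions are first corrected on null sets, so that the group law holds at every
    point. *)

HB.instance Definition _ (G : group) := gen_eqMixin (gcar G).
HB.instance Definition _ (G : group) := gen_choiceMixin (gcar G).

(** * Groups *)

Section GroupTheory.
Variable G : group.
Implicit Types x y z : G.

Lemma gmulI x y z : gmul x y = gmul x z -> y = z.
Proof. by move=> /(congr1 (gmul (ginv x))); rewrite !gmulA gmulV !gmul1. Qed.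

Lemma gmulr1 x : gmul x (gone G) = x.
Proof. by apply: (@gmulI (ginv x)); rewrite gmulA !gmulV gmul1. Qed.

Lemma gmulVr x : gmul x (ginv x) = gone G.
Proof. by apply: (@gmulI (ginv x)); rewrite gmulA gmulV gmul1 gmulr1. Qed.

Lemma gmulIr x y z : gmul y x = gmul z x -> y = z.
Proof.
by move=> /(congr1 (fun u => gmul u (ginv x))); rewrite -!gmulA gmulVr !gmulr1.
Qed.

Lemma ginvM x y : ginv (gmul x y) = gmul (ginv y) (ginv x).
Proof.
apply: (@gmulI (gmul x y)); rewrite gmulVr gmulA -(gmulA x y).
by rewrite gmulVr gmulr1 gmulVr.
Qed.

End GroupTheory.

Lemma hom1 (G H : group) (f : G -> H) : is_hom f -> f (gone G) = gone H.
Proof.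
by move=> hf; apply: (@gmulI _ (f (gone G))); rewrite -hf gmul1 gmulr1.
Qed.

Lemma homV (G H : group) (f : G -> H) : is_hom f ->
  forall x, f (ginv x) = ginv (f x).
Proof.
by move=> hf x; apply: (@gmulI _ (f x)); rewrite -hf !gmulVr hom1.
Qed.

(** * Bounded functions and small sets on a probability space *)

Section Prob.
Context (R : realType) (d : measure_display) (X : measurableType d).
Variable mu : probability X R.
Implicit Types A B : set X.

Definition pr A : R := fine (mu A).

Lemma mu_pr A : measurable A -> mu A = (pr A)%:E.
Proof. by move=> mA; rewrite /pr fineK//; apply: fin_num_measure. Qed.

Lemma pr_ge0 A : 0 <= pr A.
Proof. exact: fine_ge0. Qed.

Lemma prT : pr setT = 1.
Proof. by rewrite /pr probability_setT. Qed.

Lemma pr0 : pr set0 = 0.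
Proof. by rewrite /pr measure0. Qed.

Lemma le_pr A B : measurable A -> measurable B -> A `<=` B -> pr A <= pr B.
Proof.
by move=> mA mB AB; rewrite -lee_fin -!mu_pr//; apply: le_measure; rewrite ?inE.
Qed.

Lemma prID A B : measurable A -> measurable B ->
  pr A = pr (A `&` B) + pr (A `\` B).
Proof.
move=> mA mB; apply: EFin_inj; rewrite EFinD -!mu_pr//; last 2 first.
- exact: measurableD.
- exact: measurableI.
by rewrite addeC; apply: measureDI.
Qed.

Lemma prU_le A B : measurable A -> measurable B -> pr (A `|` B) <= pr A + pr B.
Proof.
move=> mA mB; rewrite -lee_fin EFinD -!mu_pr//; last exact: measurableU.
exact: measureU2.
Qed.

Lemma prC A : measurable A -> pr (~` A) = 1 - pr A.
Proof. by move=> mA; rewrite -prT (prID measurableT mA) setTI setTD; ring. Qed.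

Lemma pr_null A : measurable A -> mu A = 0%E <-> pr A = 0.
Proof. by move=> mA; rewrite mu_pr//; split=> [[]|->]. Qed.

Definition null A := measurable A /\ mu A = 0%E.

Lemma null_bigcup (F : nat -> set X) :
  (forall n, null (F n)) -> null (\bigcup_n F n).
Proof.
move=> F0; have mF n : measurable (F n) by case: (F0 n).
split; first exact: bigcup_measurable.
have : mu.-negligible (\bigcup_n F n).
  by apply: negligible_bigcup => n; apply/negligibleP => //; case: (F0 n).
by move/negligibleP; apply; apply: bigcup_measurable.
Qed.

Lemma null_setU A B : null A -> null B -> null (A `|` B).
Proof.
move=> [mA A0] [mB B0]; split; first exact: measurableU.
by rewrite measureU0.
Qed.

Lemma null_sub A B : measurable A -> A `<=` B -> null B -> null A.
Proof.
by move=> mA AB [mB B0]; split=> //; apply: (subset_measure0 mA mB AB B0).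
Qed.

Lemma null_bigcupT (I : Type) (e : nat -> I) (F : I -> set X) :
  (forall i, exists n, e n = i) ->
  (forall i, null (F i)) -> null (\bigcup_i F i).
Proof.
move=> he F0; rewrite (_ : \bigcup_i F i = \bigcup_n F (e n)).
  by apply: null_bigcup => n.
by apply/seteqP; split=> x [] => [i _ ?|n _ ?];
  [have [n en] := he i; exists n => //=; rewrite en | exists (e n)].
Qed.

Lemma bigcupT_measurable (I : Type) (e : nat -> I) (F : I -> set X) :
  (forall i, exists n, e n = i) ->
  (forall i, measurable (F i)) -> measurable (\bigcup_i F i).
Proof.
move=> he F0; rewrite (_ : \bigcup_i F i = \bigcup_n F (e n)).
  by apply: bigcup_measurable => n _.
by apply/seteqP; split=> x [] => [i _ ?|n _ ?];
  [have [n en] := he i; exists n => //=; rewrite en | exists (e n)].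
Qed.

(** The property may fail to be measurable, so an exceptional set is quantified existentially and
    only its measure is bounded. *)
Definition small (e : R) (P : X -> Prop) :=
  exists E : set X, [/\ measurable E, pr E <= e & forall x, ~ E x -> P x].

Lemma small_and e1 e2 (P Q : X -> Prop) : small e1 P -> small e2 Q ->
  small (e1 + e2) (fun x => P x /\ Q x).
Proof.
move=> [E [mE hE PE]] [F [mF hF QF]]; exists (E `|` F); split.
- exact: measurableU.
- by rewrite (le_trans (prU_le mE mF))// lerD.
- by move=> x /not_orP[/PE ? /QF].
Qed.

Lemma small_imp e (P Q : X -> Prop) : (forall x, P x -> Q x) ->
  small e P -> small e Q.
Proof. by move=> PQ [E [mE hE PE]]; exists E; split=> // x /PE /PQ. Qed.

Lemma small_le e1 e2 (P : X -> Prop) : e1 <= e2 -> small e1 P -> small e2 P.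
Proof.
by move=> e12 [E [mE hE PE]]; exists E; split=> //; apply: le_trans e12.
Qed.

Lemma small_ae (P : X -> Prop) : ae_prop mu P <-> small 0 P.
Proof.
split=> -[E [mE hE PE]]; exists E; split=> //.
  by move/pr_null : hE => ->.
by apply/pr_null => //; apply/eqP; rewrite eq_le hE pr_ge0.
Qed.

Lemma small_all (I : finType) (e : I -> R) (P : I -> X -> Prop) :
  (forall i, small (e i) (P i)) ->
  small (\sum_i e i) (fun x => forall i, P i x).
Proof.
move=> h; suff : forall s : seq I, small (\sum_(i <- s) e i)
    (fun x => forall i, i \in s -> P i x).
  by move=> /(_ (index_enum I)); apply: small_imp => x hx i; apply: hx;
     rewrite mem_index_enum.
elim=> [|i s ih].
  by rewrite big_nil; exists set0; split=> //; rewrite pr0.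
rewrite big_cons; apply: small_imp (small_and (h i) ih) => x [Pi Ps] j.
by rewrite in_cons => /orP[/eqP ->|/Ps].
Qed.

(** Measurability into the discrete space [T]. No sigma-algebra on [T] is involved, so [T] may also
    be [X], as for the finitely valued map of [random_map]. *)
Definition dmeas (T : Type) (q : X -> T) := forall B : set T, measurable (q @^-1` B).

Lemma dmeas_comp (T U : Type) (q : X -> T) (f : T -> U) :
  dmeas q -> dmeas (f \o q).
Proof. by move=> mq B; apply: (mq (f @^-1` B)). Qed.

Lemma dmeas_cst (T : Type) (c : T) : dmeas (fun=> c).
Proof.
move=> B; have [Bc|Bc] := pselect (B c).
  by rewrite (_ : _ @^-1` _ = setT)//; apply/seteqP; split.
by rewrite (_ : _ @^-1` _ = set0)//; apply/seteqP; split.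
Qed.

Lemma dmeas_count (T : Type) (e : nat -> T) (q : X -> T) :
  (forall t, exists n, e n = t) ->
  (forall t, measurable [set x | q x = t]) -> dmeas q.
Proof.
move=> he mq B.
rewrite (_ : q @^-1` B = \bigcup_t ([set x | q x = t] `&` [set _ | B t])).
  apply: (bigcupT_measurable he) => t; apply: measurableI => //.
  exact: (dmeas_cst t B).
by apply/seteqP; split=> x /=; [exists (q x)|case=> t _ /= [->]].
Qed.

Lemma dmeas_fin (T : finType) (q : X -> T) :
  (forall t, measurable [set x | q x = t]) -> dmeas q.
Proof.
move=> mq.
have [t0|h] := pselect (exists t0 : T, True); last first.
  move=> B; rewrite (_ : _ @^-1` _ = set0)//; apply/seteqP; split=> x //.
  by have := h; move=> []; exists (q x).
case: t0 => t0 _.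
apply: (@dmeas_count _ (fun n => odflt t0 (unpickle n))) => // t.
by exists (pickle t); rewrite pickleK.
Qed.

Lemma dmeas_ffun (I : finType) (T : finType) (q : I -> X -> T) :
  (forall i, dmeas (q i)) -> dmeas (fun x => [ffun i => q i x]).
Proof.
move=> mq; apply: dmeas_fin => t.
rewrite (_ : [set _ | _] = \bigcap_(i in [set: I]) (q i @^-1` [set t i])).
  by apply: fin_bigcap_measurable => // i _; apply: mq.
apply/seteqP; split=> x /= => [<- i _|h]; first by rewrite /= ffunE.
by apply/ffunP => i; rewrite ffunE; apply: h.
Qed.

Lemma dmeas_bool (B : set X) : measurable B -> dmeas (fun x => `[< B x >]).
Proof.
move=> mB; apply: dmeas_fin => -[].
  rewrite (_ : [set _ | _] = B)//.
  by apply/seteqP; split=> x /=; [move/asboolP|move=> ?; apply/asboolP].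
rewrite (_ : [set _ | _] = ~` B); first exact: measurableC.
by apply/seteqP; split=> x /=; [move/asboolPn|move=> ?; apply/asboolPn].
Qed.

Lemma dmeas_fun (T : Type) (q : X -> T) (f : X -> X) :
  measurable_fun setT f -> dmeas q -> dmeas (q \o f).
Proof. by move=> mf mq B; rewrite -[_ @^-1` _]setTI; exact: (mf measurableT _ (mq B)). Qed.

Lemma measurable_glue (T : Type) (e : nat -> T) (q : X -> T) (f : T -> X -> X) :
  (forall t, exists n, e n = t) -> dmeas q ->
  (forall t, measurable_fun setT (f t)) ->
  measurable_fun setT (fun x => f (q x) x).
Proof.
move=> he mq mf _ B mB; rewrite setTI.
rewrite (_ : _ @^-1` B = \bigcup_t ([set x | q x = t] `&` f t @^-1` B)).
  apply: (bigcupT_measurable he) => t; apply: measurableI.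
    exact: (mq [set t]).
  by rewrite -[_ @^-1` _]setTI; apply: mf.
by apply/seteqP; split=> x /=; [exists (q x)|case=> t _ /= [->]].
Qed.

Definition bm (f : X -> R) :=
  measurable_fun setT f /\ exists M, forall x, `|f x| <= M.

Definition Ex (f : X -> R) : R := (\int[mu]_x f x)%R.

Lemma bm_int f : bm f -> mu.-integrable setT (EFin \o f).
Proof.
move=> [mf [M hM]]; apply: measurable_bounded_integrable => //.
  by rewrite (le_lt_trans (probability_le1 _ _))// ltry.
by exists M; split; [exact: num_real|move=> y My x _ /=; apply: le_trans (hM x) (ltW My)].
Qed.

Lemma bm_cst c : bm (fun=> c).
Proof. by split=> //; exists `|c|. Qed.

Lemma bmD f g : bm f -> bm g -> bm (fun x => f x + g x).
Proof.
move=> [mf [M hM]] [mg [N hN]]; split; first exact: measurable_funD.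
by exists (M + N) => x; rewrite (le_trans (ler_normD _ _))// lerD.
Qed.

Lemma bmM f g : bm f -> bm g -> bm (fun x => f x * g x).
Proof.
move=> [mf [M hM]] [mg [N hN]]; split; first exact: measurable_funM.
by exists (M * N) => x; rewrite normrM ler_pM.
Qed.

Lemma bmZ c f : bm f -> bm (fun x => c * f x).
Proof. by move=> hf; apply: bmM => //; apply: bm_cst. Qed.

Lemma bm_sum (I : Type) (s : seq I) (f : I -> X -> R) : (forall i, bm (f i)) ->
  bm (fun x => \sum_(i <- s) f i x).
Proof.
move=> hf; elim: s => [|i s ih].
  rewrite (_ : (fun _ => _) = fun=> 0); first exact: bm_cst.
  by apply/funext => x; rewrite big_nil.
rewrite (_ : (fun _ => _) = fun x => f i x + \sum_(j <- s) f j x).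
  exact: bmD.
by apply/funext => x; rewrite big_cons.
Qed.

Lemma bm_indic (B : set X) : measurable B -> bm (\1_B).
Proof.
move=> mB; split; first exact: measurable_indic.
by exists 1 => x; rewrite indicE; case: (_ \in _); rewrite ?normr1// normr0.
Qed.

Lemma Ex_cst c : Ex (fun=> c) = c.
Proof.
by rewrite /Ex Rintegral_cst//= -/(pr _) prT mulr1.
Qed.

Lemma ExD f g : bm f -> bm g -> Ex (fun x => f x + g x) = Ex f + Ex g.
Proof. by move=> hf hg; rewrite /Ex RintegralD//; apply: bm_int. Qed.

Lemma ExZ c f : bm f -> Ex (fun x => c * f x) = c * Ex f.
Proof. by move=> hf; rewrite /Ex RintegralZl//; apply: bm_int. Qed.

Lemma Ex_sum (I : Type) (s : seq I) (f : I -> X -> R) : (forall i, bm (f i)) ->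
  Ex (fun x => \sum_(i <- s) f i x) = \sum_(i <- s) Ex (f i).
Proof.
move=> hf; elim: s => [|i s ih].
  rewrite big_nil -[RHS](Ex_cst 0); congr Ex.
  by apply/funext => x; rewrite big_nil.
rewrite big_cons -ih -ExD//; last exact: bm_sum.
by congr Ex; apply/funext => x; rewrite big_cons.
Qed.

Lemma le_Ex f g : bm f -> bm g -> (forall x, f x <= g x) -> Ex f <= Ex g.
Proof. by move=> hf hg fg; apply: le_Rintegral => //; apply: bm_int. Qed.

Lemma Ex_indic B : measurable B -> Ex \1_B = pr B.
Proof. by move=> mB; rewrite /Ex /Rintegral integral_indic// setIT. Qed.

End Prob.

(** * Actions, saturations and matchings *)

Section MeasurePreserving.
Context (R : realType) (d : measure_display) (X : measurableType d).
Variable mu : probability X R.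
Implicit Types A B : set X.

Lemma image_aut (T S : X -> X) B : cancel T S -> cancel S T ->
  T @` B = S @^-1` B.
Proof.
move=> TS ST; apply/seteqP; split=> x /=; first by case=> y By <-; rewrite TS.
by exists (S x); rewrite ?ST.
Qed.

Lemma mp_aut_pair_sym (T S : X -> X) : mp_aut_pair mu T S -> mp_aut_pair mu S T.
Proof.
move=> [mT mS TS ST h]; split=> // A mA.
have mSA : measurable (S @^-1` A) by rewrite -[_ @^-1` _]setTI; apply: mS.
rewrite -(h _ mSA); congr (mu _); apply/seteqP.
by split=> x /=; rewrite TS.
Qed.

Lemma mp_aut_pair_comp (T S T' S' : X -> X) :
  mp_aut_pair mu T S -> mp_aut_pair mu T' S' ->
  mp_aut_pair mu (T \o T') (S' \o S).
Proof.
move=> [mT mS TS ST h] [mT' mS' TS' ST' h']; split.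
- exact: measurableT_comp.
- exact: measurableT_comp.
- by move=> x /=; rewrite TS TS'.
- by move=> x /=; rewrite ST' ST.
move=> A mA; have mTA : measurable (T @^-1` A).
  by rewrite -[_ @^-1` _]setTI; apply: mT.
by rewrite -(h _ mA) -(h' _ mTA).
Qed.

Lemma mp_aut_pair_id : mp_aut_pair mu id id.
Proof. by split=> //; apply: measurable_id. Qed.

Lemma small_comp e (P : X -> Prop) (T : X -> X) : measurable_fun setT T ->
  (forall A, measurable A -> mu (T @^-1` A) = mu A) ->
  small mu e P -> small mu e (P \o T).
Proof.
move=> mT h [E [mE hE PE]]; exists (T @^-1` E); split.
- by rewrite -[_ @^-1` _]setTI; apply: mT.
- by rewrite /pr h.
- by move=> x /PE.
Qed.

Lemma measurable_preim (T : X -> X) A : measurable_fun setT T -> measurable A ->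
  measurable (T @^-1` A).
Proof. by move=> mT mA; rewrite -[_ @^-1` _]setTI; apply: mT. Qed.

Lemma measurable_prop (P : Prop) : measurable [set _ : X | P].
Proof.
have [p|np] := pselect P.
  by rewrite (_ : [set _ | _] = setT)//; apply/seteqP; split.
by rewrite (_ : [set _ | _] = set0)//; apply/seteqP; split.
Qed.

Section Action.
Variable G : group.

(** Unlike in [pmp_action], the laws hold at every point, so orbits and invariant sets are literal
    ones; bijectivity follows from the laws. *)
Definition act (a : G -> X -> X) :=
  [/\ forall g, measurable_fun setT (a g),
      forall g A, measurable A -> mu (a g @^-1` A) = mu A,
      forall x, a (gone G) x = x &
      forall g h x, a (gmul g h) x = a g (a h x)].

Section Exact.
Variable a : G -> X -> X.
Hypothesis ha : act a.

Lemma actK g : cancel (a g) (a (ginv g)).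
Proof. by case: ha => _ _ a1 aM x; rewrite -aM gmulV a1. Qed.

Lemma actVK g : cancel (a (ginv g)) (a g).
Proof. by case: ha => _ _ a1 aM x; rewrite -aM gmulVr a1. Qed.

Lemma act_pair g : mp_aut_pair mu (a g) (a (ginv g)).
Proof.
case: (ha) => ma mua a1 aM.
by split=> //; [exact: actK|exact: actVK|move=> A mA; apply: mua].
Qed.

Lemma act_pmp : pmp_action mu a.
Proof.
split=> [g|g h]; first by exists (a (ginv g)); apply: act_pair.
by exists set0; split=> // x _; case: ha.
Qed.

Lemma act_null g A : null mu A -> null mu (a g @^-1` A).
Proof.
by case: ha => ma mua _ _ [mA A0]; split; [exact: measurable_preim|rewrite mua].
Qed.

Definition invariant (Z : set X) := forall g x, Z x -> Z (a g x).

Definition saturation (A : set X) : set X := [set x | exists g, A (a g x)].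

Lemma invariantE Z g x : invariant Z -> Z (a g x) <-> Z x.
Proof. by move=> hZ; split=> [/(hZ (ginv g))|/(hZ g)//]; rewrite actK. Qed.

Lemma saturation_inv A : invariant (saturation A).
Proof.
case: ha => _ _ a1 aM g x [h Ah]; exists (gmul h (ginv g)).
by rewrite aM actK.
Qed.

Lemma sub_saturation A : A `<=` saturation A.
Proof. by case: ha => _ _ a1 aM x Ax; exists (gone G); rewrite a1. Qed.

Lemma saturationE A : saturation A = \bigcup_g (a g @^-1` A).
Proof. by apply/seteqP; split=> x [g]; [exists g|move=> _; exists g]. Qed.

Variable e : nat -> G.
Hypothesis he : forall g, exists n, e n = g.

Lemma saturation_measurable A : measurable A -> measurable (saturation A).
Proof.
move=> mA; rewrite saturationE; apply: (bigcupT_measurable he) => g.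
by case: ha => ma _ _ _; apply: measurable_preim.
Qed.

Lemma saturation_null A : null mu A -> null mu (saturation A).
Proof.
move=> mA; rewrite saturationE; apply: (null_bigcupT he) => g.
exact: act_null.
Qed.

Let gam n := a (e n).

(** Both unions are disjoint, and each piece is moved by a single group element, which preserves the
    measure. *)
Lemma mu_pieces (W : nat -> set X) : (forall n, measurable (W n)) ->
  (forall i j x, W i x -> W j x -> i = j) ->
  (forall i j x y, W i x -> W j y -> gam i x = gam j y -> i = j) ->
  mu (\bigcup_n W n) = mu (\bigcup_n (gam n @` W n)).
Proof.
move=> mW d1 d2.
have mgW n : measurable (gam n @` W n).
  rewrite (image_aut _ (actK _) (actVK _)).
  by apply: measurable_preim => //; case: ha.
rewrite !measure_bigcup//.
- apply: eq_eseriesr => n _; case: ha => _ mua _ _.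
  rewrite (image_aut _ (actK _) (actVK _)); exact: esym (mua _ _ (mW n)).
- move=> i j _ _ [x [[y Wy <-] [z Wz /esym yz]]].
  exact: d2 Wy Wz yz.
- by move=> i j _ _ [x [Wi Wj]]; apply: d1 Wi Wj.
Qed.

(** [p] is the index of the group element applied at a source, [q] the index of the one that arrives
    at a target. The two identities make the glued maps inverse to each other, and [mu_pieces]
    yields invariance of the measure. *)
Lemma glue_mp (p q : X -> nat) : dmeas p -> dmeas q ->
  (forall x, q (gam (p x) x) = p x) ->
  (forall y, p (a (ginv (e (q y))) y) = q y) ->
  mp_aut_pair mu (fun x => gam (p x) x) (fun y => a (ginv (e (q y))) y).
Proof.
move=> mp mq qp pq; case: (ha) => ma mua a1 aM.
have mR : measurable_fun setT (fun x => gam (p x) x).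
  apply: (measurable_glue (e := id) (q := p) (f := gam)) => // [t|t]; first by exists t.
  exact: ma.
split=> //.
- apply: (measurable_glue (e := id) (q := q) (f := fun n => a (ginv (e n)))) => // t.
  by exists t.
- by move=> x; rewrite qp actK.
- by move=> y; rewrite pq /gam actVK.
move=> B mB; pose W n := [set x | p x = n] `&` ((fun x => gam (p x) x) @^-1` B).
rewrite (_ : _ @^-1` B = \bigcup_n W n); last first.
  by apply/seteqP; split=> x /=; [exists (p x)|case=> n _ []].
rewrite mu_pieces.
- congr (mu _); apply/seteqP; split=> y.
    by case=> n _ [x [/= <- Bx] <-].
  move=> By; exists (q y) => //; exists (a (ginv (e (q y))) y).
    by split=> /=; rewrite pq// /gam actVK.
  by rewrite /gam actVK.
- by move=> n; apply: measurableI; [exact: (mp [set n])|exact: measurable_preim].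
- by move=> i j x [/= <- _] [].
- by move=> i j x y [/= <- _] [/= <- _] /(congr1 q); rewrite !qp.
Qed.

Fixpoint greedy_used (A : nat -> set X) (n : nat) : set X * set X :=
  if n is k.+1 then
    let: (U, V) := greedy_used A k in
    let M := A k `\` U `\` (gam k @^-1` V) in (U `|` M, V `|` (gam k @` M))
  else (set0, set0).

(** The last clause is maximality: every admissible pair has at least one used end, since otherwise
    its own stage would have matched it. *)
Lemma greedy (A : nat -> set X) : (forall n, measurable (A n)) ->
  exists M : nat -> set X, [/\ forall n, measurable (M n),
    forall n, M n `<=` A n,
    forall i j x, M i x -> M j x -> i = j,
    forall i j x y, M i x -> M j y -> gam i x = gam j y -> i = j &
    forall n x, A n x -> (exists k, M k x) \/
      exists k y, M k y /\ gam n x = gam k y].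
Proof.
move=> mA; pose U n := (greedy_used A n).1; pose V n := (greedy_used A n).2.
pose M n := A n `\` U n `\` (gam n @^-1` V n).
have US n : U n.+1 = U n `|` M n.
  by rewrite /U /M /U /V /=; case: (greedy_used A n).
have VS n : V n.+1 = V n `|` (gam n @` M n).
  by rewrite /V /M /U /V /=; case: (greedy_used A n).
have mUV n : measurable (U n) /\ measurable (V n).
  elim: n => [|n [mU mV]]; first by split; apply: measurable0.
  have mM : measurable (M n).
    apply: measurableD; first exact: measurableD.
    by apply: measurable_preim => //; case: ha => + _ _ _; apply.
  rewrite US VS; split; apply: measurableU => //.
  rewrite (image_aut _ (actK _) (actVK _)).
  by apply: measurable_preim => //; case: ha.
have UE n x : U n x <-> exists2 k, (k < n)%N & M k x.
  elim: n => [|n ih]; first by split=> // -[].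
  rewrite US; split.
    case=> [/ih [k kn Mk]|Mn]; last by exists n.
    by exists k => //; apply: ltnW.
  case=> k; rewrite ltnS leq_eqVlt => /orP[/eqP ->|kn] Mk; first by right.
  by left; apply/ih; exists k.
have VE n y : V n y <-> exists2 k, (k < n)%N & (gam k @` M k) y.
  elim: n => [|n ih]; first by split=> // -[].
  rewrite VS; split.
    case=> [/ih [k kn Mk]|Mn]; last by exists n.
    by exists k => //; apply: ltnW.
  case=> k; rewrite ltnS leq_eqVlt => /orP[/eqP ->|kn] Mk; first by right.
  by left; apply/ih; exists k.
have h1 i j x : (i < j)%N -> M i x -> M j x -> False.
  by move=> ij Mi [[_ +] _]; apply; apply/UE; exists i.
have h2 i j x y : (i < j)%N -> M i x -> M j y -> gam i x = gam j y -> False.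
  move=> ij Mi [_ +] xy; apply; apply/VE; exists i => //.
  by exists x.
exists M; split.
- move=> n; have [mU mV] := mUV n.
  apply: measurableD; first exact: measurableD.
  by apply: measurable_preim => //; case: ha => + _ _ _; apply.
- by move=> n x [[]].
- by move=> i j x Mi Mj; case: (ltngtP i j) => // ij; exfalso;
    [exact: h1 Mi Mj|exact: h1 Mj Mi].
- move=> i j x y Mi Mj xy; case: (ltngtP i j) => // ij; exfalso.
    exact: h2 Mi Mj xy.
  exact: h2 Mj Mi (esym xy).
- move=> n x An.
  have [/UE [k _ Mk]|nU] := pselect (U n x); first by left; exists k.
  have [/VE [k _ [y My yx]]|nV] := pselect (V n (gam n x)).
    by right; exists k, y.
  by left; exists n.
Qed.

(* A maximal partial matching of sources and targets of equal colour is taken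
   greedily along an enumeration of the group, and is then extended by a second
   round which ignores colours.  Unmatched sources and unmatched targets lie in
   disjoint invariant sets: on the saturation of the unmatched sources of a given
   colour all targets of this colour are used, so the hypothesis bounds the
   measure of these sources.  After the second round the same argument shows that
   the leftovers are null. *)
Theorem matching (C : finType) (s t : X -> C) (del : R) :
  dmeas s -> dmeas t ->
  (forall Z j, measurable Z -> invariant Z ->
    pr mu ([set x | s x = j] `&` Z) <= pr mu ([set x | t x = j] `&` Z) + del) ->
  exists T S : X -> X, [/\ mp_aut_pair mu T S,
    forall x, exists g, T x = a g x &
    small mu (\sum_(j : C) del) (fun x => s x = t (T x))].
Proof.
move=> ms mt hst; case: (ha) => ma mua a1 aM.
have mg n : measurable_fun setT (gam n) by apply: ma.
have mim n B : measurable B -> measurable (gam n @` B).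
  by move=> mB; rewrite (image_aut _ (actK _) (actVK _)); apply: measurable_preim.
have [|M1 [mM1 M1A M1d M1i M1max]] := @greedy (fun n => [set x | s x = t (gam n x)]).
  move=> n; rewrite (_ : [set _ | _] = \bigcup_(j in [set: C])
      ([set x | s x = j] `&` [set x | t (gam n x) = j])).
    apply: fin_bigcup_measurable => // j _; apply: measurableI.
      exact: (ms [set j]).
    exact: (dmeas_fun (mg n) mt [set j]).
  by apply/seteqP; split=> x /=; [exists (s x)|case=> j _ [/= -> ->]].
pose U1 := \bigcup_n M1 n; pose V1 := \bigcup_n (gam n @` M1 n).
have mU1 : measurable U1 by apply: bigcup_measurable.
have mV1 : measurable V1 by apply: bigcup_measurable => n _; apply: mim.
have [|M2 [mM2 M2A M2d M2i M2max]] := @greedy (fun n => ~` U1 `&` gam n @^-1` (~` V1)).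
  by move=> n; apply: measurableI; [|apply: measurable_preim => //]; apply: measurableC.
pose M n := M1 n `|` M2 n.
have mM n : measurable (M n) by apply: measurableU.
have Md i j x : M i x -> M j x -> i = j.
  case=> [Mi|Mi] [Mj|Mj]; [exact: M1d Mi Mj| | |exact: M2d Mi Mj].
    by case: (M2A _ _ Mj) => + _; case; exists i.
  by case: (M2A _ _ Mi) => + _; case; exists j.
have Mi i j x y : M i x -> M j y -> gam i x = gam j y -> i = j.
  case=> [Mi|Mi] [Mj|Mj] xy; [exact: M1i Mi Mj xy| | |exact: M2i Mi Mj xy].
    by case: (M2A _ _ Mj) => _ +; case; exists i => //; exists x.
  by case: (M2A _ _ Mi) => _ +; case; exists j => //; exists y.
pose S' := ~` \bigcup_n M n; pose T' := ~` \bigcup_n (gam n @` M n).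
have mS' : measurable S' by apply/measurableC/bigcup_measurable.
have mT' : measurable T'.
  by apply/measurableC/bigcup_measurable => n _; apply: mim.
(* Otherwise the second round, which ignores colours, would have used one of these two points. *)
have ST x g : S' x -> ~ T' (a g x).
  move=> Sx Tx; have [n en] := he g.
  have nU1 : ~ U1 x by case=> k _ Mk; apply: Sx; exists k => //; left.
  have nV1 : ~ V1 (gam n x).
    rewrite /gam en => -[k _ [y My yx]]; apply: Tx.
    by exists k => //; exists y => //; left.
  have [[k Mk]|[k [y [My yx]]]] := M2max n x (conj nU1 nV1).
    by apply: Sx; exists k => //; right.
  apply: Tx; exists k => //; exists y; first by right.
  by rewrite -yx /gam en.
pose Z := saturation S'; pose Z' := saturation T'.
have mZ : measurable Z by apply: saturation_measurable.
have mZ' : measurable Z' by apply: saturation_measurable.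
have iZ : invariant Z by apply: saturation_inv.
have iZ' : invariant Z' by apply: saturation_inv.
have nullD B D : measurable B -> measurable D -> D `<=` B ->
    mu (B `\` D) = mu B -> null mu D.
  move=> mB mD DB h; split=> //; apply/pr_null => //.
  have := prID mu mB mD; rewrite (setIidr DB) /pr h; lra.
(* By [ST] every point of [Z] is a used target, so the matched sources in [Z] are carried onto all
   of [Z] and have its full measure. *)
have nS : null mu S'.
  apply: (@nullD Z) => //; first exact: sub_saturation.
  rewrite (_ : Z `\` S' = \bigcup_n (M n `&` Z)); last first.
    apply/seteqP; split=> x; last first.
      by case=> n _ [Mn Zx]; split=> // Sx; apply: Sx; exists n.
    by case=> Zx /contrapT [n _ Mn]; exists n.
  rewrite mu_pieces.
  - congr (mu _); apply/seteqP; split=> y.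
      by case=> n _ [x [_ Zx] <-]; apply: iZ.
    case=> g Sg; have : ~ T' y by rewrite -(actK g y); apply: ST.
    move=> /contrapT [n _ [x Mx xy]]; exists n => //; exists x => //; split=> //.
    by apply/(invariantE (e n) x iZ); rewrite -/(gam n x) xy; exists g.
  - by move=> n; apply: measurableI.
  - by move=> i j x [+ _] [+ _]; apply: Md.
  - by move=> i j x y [+ _] [+ _]; apply: Mi.
have nT : null mu T'.
  apply: (@nullD Z') => //; first exact: sub_saturation.
  rewrite (_ : Z' `\` T' = \bigcup_n (gam n @` (M n `&` Z'))); last first.
    apply/seteqP; split=> x; last first.
      case=> n _ [y [My Zy] <-]; split; first exact: iZ'.
      by move=> Tx; apply: Tx; exists n => //; exists y.
    case=> Zx /contrapT [n _ [y My yx]]; exists n => //; exists y => //.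
    by split=> //; apply/(invariantE (e n) y iZ'); rewrite -/(gam n y) yx.
  rewrite -mu_pieces.
  - congr (mu _); apply/seteqP; split=> x; first by case=> n _ [].
    case=> g Tg; have : ~ S' x by move=> /(ST _ g).
    move=> /contrapT [n _ Mx]; exists n => //; split=> //.
    by exists g.
  - by move=> n; apply: measurableI.
  - by move=> i j x [+ _] [+ _]; apply: Md.
  - by move=> i j x y [+ _] [+ _]; apply: Mi.
pose N := Z `|` Z'.
have [mN nN] : null mu N by apply: null_setU; apply: saturation_null.
have iN : invariant N by move=> g x [/iZ|/iZ'] h; [left|right].
(* On the null invariant set [N] the identity, of index [n0], replaces the matching, so that the
   result is a bijection of all of [X]. *)
have [n0 en0] := he (gone G).
pose idx x n := (~ N x /\ M n x) \/ (N x /\ n = n0).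
have idx_ex x : exists n, idx x n.
  have [Nx|Nx] := pselect (N x); first by exists n0; right.
  have : ~ S' x by move=> Sx; apply: Nx; left; apply: sub_saturation.
  by move=> /contrapT [n _ Mn]; exists n; left.
have idx_un x i j : idx x i -> idx x j -> i = j.
  by case=> [[nNx Mx]|[Nx ->]] [[nNx' Mx']|[Nx' ->]] //; apply: Md Mx Mx'.
have gN n x : N (gam n x) <-> N x by apply: invariantE.
have jdx_ex y : exists n, idx (a (ginv (e n)) y) n.
  have [Ny|Ny] := pselect (N y).
    by exists n0; right; split=> //; apply: iN.
  have : ~ T' y by move=> Ty; apply: Ny; right; apply: sub_saturation.
  move=> /contrapT [n _ [x Mx xy]]; exists n; left.
  by rewrite -xy /gam actK; split=> // /(gN n); rewrite xy.
have jdx_un y i j : idx (a (ginv (e i)) y) i -> idx (a (ginv (e j)) y) j -> i = j.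
  have Nx k : N (a (ginv (e k)) y) <-> N y by apply: invariantE.
  case=> [[/Nx nN1 M1']|[/Nx N1 ->]] [[/Nx nN2 M2']|[/Nx N2 ->]] //.
  by apply: Mi M1' M2' _; rewrite /gam !actVK.
have [p hp] := choice idx_ex; have [q hq] := choice jdx_ex.
have md (f : X -> nat) (P : nat -> set X) : (forall n, measurable (P n)) ->
    (forall x n, f x = n <-> P n x) -> dmeas f.
  move=> mP hf; apply: (dmeas_count (e := id)) => [n|n]; first by exists n.
  rewrite (_ : [set _ | _] = P n)//.
  by apply/seteqP; split=> x /= /hf.
have midx n : measurable [set x | idx x n].
  rewrite (_ : [set _ | _] = (M n `\` N) `|` (N `&` [set _ | n = n0])).
    apply: measurableU; first exact: measurableD.
    by apply: measurableI => //; exact: measurable_prop.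
  by apply/seteqP; split=> x /=; rewrite /idx; tauto.
have dp : dmeas p.
  apply: (md _ (fun n => [set x | idx x n])) => // x n.
  by split=> [<-|/= hn]; [exact: hp|exact: idx_un (hp x) hn].
have dq : dmeas q.
  apply: (md _ (fun n => a (ginv (e n)) @^-1` [set x | idx x n])).
    by move=> n; apply: measurable_preim.
  move=> x n.
  by split=> [<-|/= hn]; [exact: hq|exact: jdx_un (hq x) hn].
have qp x : q (gam (p x) x) = p x.
  by apply: jdx_un (hq _) _; rewrite /gam actK; apply: hp.
have pq y : p (a (ginv (e (q y))) y) = q y by apply: idx_un (hp _) (hq y).
exists (fun x => gam (p x) x), (fun y => a (ginv (e (q y))) y); split.
- exact: glue_mp.
- by move=> x; exists (e (p x)).
pose Sj j := [set x | s x = j] `\` U1.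
have mSj j : measurable (Sj j) by apply: measurableD => //; apply: (ms [set j]).
have sSj j : pr mu (Sj j) <= del.
  pose Zj := saturation (Sj j).
  have mZj : measurable Zj by apply: saturation_measurable.
  have iZj : invariant Zj by apply: saturation_inv.
  have := hst Zj j mZj iZj.
  have mA : measurable ([set x | s x = j] `&` Zj).
    by apply: measurableI => //; apply: (ms [set j]).
  rewrite (prID mu mA (mSj j)) (setIidr _); last first.
    by move=> x Sx; split; [case: Sx|apply: sub_saturation].
  suff -> : pr mu (([set x | s x = j] `&` Zj) `\` Sj j) =
            pr mu ([set x | t x = j] `&` Zj) by lra.
  congr fine; pose W n := M1 n `&` ([set x | s x = j] `&` Zj).
  rewrite (_ : _ `\` _ = \bigcup_n W n); last first.
    apply/seteqP; split=> x; last first.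
      by case=> n _ [Mn [sx Zx]]; split=> // -[_]; apply; exists n.
    case=> -[/= sx Zx] nS'; have [[n _ Mn]|nU] := pselect (U1 x); first by exists n.
    by case: nS'.
  rewrite mu_pieces.
  - congr (mu _); apply/seteqP; split=> y.
      case=> n _ [x [Mx [/= sx Zx]] <-]; split; last exact: iZj.
      by rewrite /= -(M1A _ _ Mx).
    case=> /= ty [g [/= sg Ug]]; have [n en] := he (ginv g).
    have gy : gam n (a g y) = y by rewrite /gam en actK.
    have [|[k Mk]|[k [z [Mz yz]]]] := M1max n (a g y).
    - by rewrite /= gy sg ty.
    - by case: Ug; exists k.
    exists k => //; exists z; last by rewrite -yz gy.
    split=> //; split; first by rewrite /= (M1A _ _ Mz) -yz gy.
    by apply/(invariantE (e k) z iZj); rewrite -/(gam k z) -yz gy; exists g.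
  - move=> n; apply: measurableI => //.
  - by move=> i j' x [+ _] [+ _]; apply: M1d.
  - by move=> i j' x y [+ _] [+ _]; apply: M1i.
have hN : small mu 0 (fun x => ~ N x).
  by exists N; split=> //; move/pr_null : nN => ->.
have hS : small mu (\sum_(j : C) del) (fun x => forall j, ~ Sj j x).
  by apply: small_all => j; exists (Sj j).
apply: small_le (small_imp _ (small_and hN hS)); first by rewrite add0r.
move=> x [nNx /(_ (s x)) nSx].
have [n _ Mn] : U1 x by apply: contrapT => nU; apply: nSx.
have -> : p x = n by apply: idx_un (hp x) _; left; split=> //; left.
exact: M1A.
Qed.

End Exact.

(** Countability puts all failures of the homomorphism law, and all points with a translate at such
    a failure, into one null set. Its complement is mapped into itself and the law is exact there;
    on the null set the action is made trivial. *)
Lemma exact_action (e : nat -> G) (a : G -> X -> X) :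
  (forall g, exists n, e n = g) -> pmp_action mu a ->
  exists a', act a' /\ ae_prop mu (fun x => forall g, a' g x = a g x).
Proof.
move=> he [haut hhom].
have [ai hai] := choice haut.
have [N hN] := choice (fun gh : G * G => hhom gh.1 gh.2).
pose N0 := \bigcup_g \bigcup_h N (g, h).
have nN0 : null mu N0.
  apply: (null_bigcupT he) => g; apply: (null_bigcupT he) => h.
  by case: (hN (g, h)).
have ma g : measurable_fun setT (a g) by case: (hai g).
have mua g A : measurable A -> mu (a g @^-1` A) = mu A by case: (hai g) => _ _ _ _; apply.
pose N1 := N0 `|` \bigcup_g (a g @^-1` N0).
have [mN1 nN1] : null mu N1.
  apply: null_setU => //; apply: (null_bigcupT he) => g.
  by case: nN0 => mN0 N00; split; [exact: measurable_preim|rewrite mua].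
have aM g h x : ~ N1 x -> a (gmul g h) x = a g (a h x).
  move=> N1x; case: (hN (g, h)) => _ _; apply => Nx.
  by apply: N1x; left; exists g => //; exists h.
have inv h x : ~ N1 x -> ~ N1 (a h x).
  move=> N1x [N0x|[g _ Ng]]; apply: (N1x); right; first by exists h.
  by exists (gmul g h) => //=; rewrite aM.
have mN1c : measurable (~` N1) by apply: measurableC.
pose a' g x := if `[< N1 x >] then x else a g x.
have a'N g x : N1 x -> a' g x = x by rewrite /a'; case: asboolP.
have a'E g x : ~ N1 x -> a' g x = a g x by rewrite /a'; case: asboolP.
exists a'; split; last by exists N1; split=> // x N1x g; apply: a'E.
have pre g A : a' g @^-1` A = (A `&` N1) `|` (a g @^-1` A `&` ~` N1).
  apply/seteqP; split=> x /=; have [Nx|Nx] := pselect (N1 x).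
  - by rewrite a'N//; left.
  - by rewrite a'E//; right.
  - by rewrite a'N// => -[[]|[]].
  - by rewrite a'E// => -[[]|[]].
split.
- move=> g _ A mA; rewrite setTI pre; apply: measurableU; apply: measurableI => //.
  exact: measurable_preim.
- move=> g A mA; have mgA : measurable (a g @^-1` A) by apply: measurable_preim.
  have n0 B : measurable B -> mu (B `&` N1) = 0%E.
    by move=> mB; apply: (subset_measure0 _ mN1 _ nN1) => //; exact: measurableI.
  rewrite pre setUC (measureU0 _ _ (n0 A mA)); [|exact: measurableI..].
  have h : mu (a g @^-1` A) =
      (mu (a g @^-1` A `\` N1) + mu (a g @^-1` A `&` N1))%E by apply: measureDI.
  by rewrite -(mua g A mA) h n0// adde0 setDE.
- move=> x; have [Nx|Nx] := pselect (N1 x); first by rewrite a'N.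
  rewrite a'E//; case: (hai (gone G)) => _ _ aK _ _.
  (* Off [N1] the map [a (gone G)] is idempotent, and it is injective, so it fixes [x]. *)
  by apply: (can_inj aK); rewrite -aM// gmul1.
- move=> g h x; have [Nx|Nx] := pselect (N1 x); first by rewrite !a'N.
  by rewrite !a'E//; [exact: aM|exact: inv].
Qed.

End Action.
End MeasurePreserving.

(** * Random maps with independent cells *)

Section ProductWeights.
Context (R : realFieldType) (K W : finType) (w : W -> R).
Hypothesis w0 : forall o, 0 <= w o.
Hypothesis w1 : \sum_o w o = 1.

(** The product law: one independent sample with law [w] for each element of [K]. *)
Definition pweight (f : {ffun K -> W}) : R := \prod_k w (f k).

Lemma pweight_ge0 f : 0 <= pweight f.
Proof. by apply: prodr_ge0. Qed.

Lemma sum_pweight : \sum_f pweight f = 1.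
Proof.
rewrite /pweight -(bigA_distr_bigA (fun _ => w)) big1// => k _.
Qed.

Lemma sum_pweight2 (k l : K) (u v : W -> R) : k != l ->
  \sum_f pweight f * (u (f k) * v (f l)) =
  (\sum_o w o * u o) * (\sum_o w o * v o).
Proof.
move=> kl; have lk : l == k = false by rewrite eq_sym (negbTE kl).
(* Coordinates other than [k] and [l] carry the function [1], whose mean is [1]; the sum of products
   then factors. *)
pose F i o := w o * (if i == k then u o else if i == l then v o else 1).
transitivity (\sum_(f : {ffun K -> W}) \prod_i F i (f i)).
  apply: eq_bigr => f _; rewrite /F big_split /=; congr (_ * _).
  rewrite (bigD1 k)//= eqxx; congr (_ * _).
  rewrite (bigD1 l) ?lk//= eqxx big1 ?mulr1// => i.
  by case/andP => /negbTE -> /negbTE ->.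
rewrite -(bigA_distr_bigA F) (bigD1 k)//=; congr (_ * _).
  by apply: eq_bigr => o _; rewrite /F eqxx.
rewrite (bigD1 l) ?lk//= [X in _ * X]big1 ?mulr1 => [|i].
  by apply: eq_bigr => o _; rewrite /F lk eqxx.
move=> /andP[/negbTE ik /negbTE il]; rewrite -[RHS]w1.
by apply: eq_bigr => o _; rewrite /F ik il mulr1.
Qed.

Lemma exists_le_mean (J : finType) (W' : J -> R) (h : J -> R) (M : R) :
  (forall j, 0 <= W' j) -> \sum_j W' j = 1 -> \sum_j W' j * h j <= M ->
  exists j, h j <= M.
Proof.
move=> W0 W1 hM; apply: contrapT => /forallNP hn.
have h0 j : 0 <= W' j * (h j - M).
  by apply: mulr_ge0 => //; have /negP := hn j; rewrite -ltNge => /ltW; lra.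
have le0 : \sum_j W' j * (h j - M) <= 0.
  under eq_bigr do rewrite mulrBr.
  by rewrite sumrB -mulr_suml W1; lra.
have /psumr_eq0P hz : \sum_j W' j * (h j - M) = 0.
  by apply/eqP; rewrite eq_le le0 sumr_ge0.
suff : \sum_j W' j = 0 by rewrite W1 => /eqP; rewrite oner_eq0.
apply: big1 => j _; have /eqP := hz (fun j _ => h0 j) j isT.
rewrite mulf_eq0 => /orP[/eqP//|/eqP e].
by case: (hn j); move: e; lra.
Qed.

(** Expanding the square leaves covariances. Distinct coordinates are independent, so only the at
    most [n * q] pairs with equal coordinates contribute, each at most [1], and the prefactor is the
    inverse square of [n]. *)
Lemma mean_variance (n q : nat) (z : 'I_n -> K) (v : 'I_n -> W -> R) (p : R) :
  (0 < n)%N -> 0 <= p <= 1 ->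
  (forall s o, 0 <= v s o <= 1) -> (forall s, \sum_o w o * v s o = p) ->
  (forall s, (#|[pred s' | z s == z s']| <= q)%N) ->
  \sum_f pweight f * (n%:R^-1 * (\sum_s v s (f (z s))) - p) ^+ 2 <= q%:R / n%:R.
Proof.
move=> n0 /andP[p0 p1] v01 vp hq; have nR : 0 < n%:R :> R by rewrite ltr0n.
pose y (f : {ffun K -> W}) s := v s (f (z s)) - p.
have -> : \sum_f pweight f * (n%:R^-1 * (\sum_s v s (f (z s))) - p) ^+ 2 =
    n%:R^-1 ^+ 2 * \sum_s \sum_s' \sum_f pweight f * (y f s * y f s').
  have sq (f : {ffun K -> W}) : (n%:R^-1 * (\sum_s v s (f (z s))) - p) ^+ 2 =
      n%:R^-1 ^+ 2 * \sum_s \sum_s' y f s * y f s'.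
    have -> : n%:R^-1 * (\sum_s v s (f (z s))) - p = n%:R^-1 * \sum_s y f s.
      rewrite /y sumrB mulrBr sumr_const card_ord -[p *+ n]mulr_natl.
      by rewrite mulrA mulVf ?mul1r// gt_eqF.
    rewrite exprMn; congr (_ * _); rewrite expr2 mulr_suml.
    by apply: eq_bigr => s _; rewrite mulr_sumr.
  under eq_bigr => f _ do rewrite sq mulrCA mulr_sumr.
  rewrite -mulr_sumr; congr (_ * _); rewrite exchange_big /=.
  apply: eq_bigr => s _; rewrite exchange_big /=; apply: eq_bigr => f _.
  by rewrite mulr_sumr.
have step s : \sum_s' \sum_f pweight f * (y f s * y f s') <= q%:R.
  rewrite (bigID (fun s' => z s == z s')) /= [X in _ + X]big1 ?addr0; last first.
    move=> s' zs; rewrite (sum_pweight2 (fun o => v s o - p) (fun o => v s' o - p) zs).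
    under eq_bigr do rewrite mulrBr.
    by rewrite sumrB vp -mulr_suml w1 mul1r subrr mul0r.
  apply: (@le_trans _ _ (\sum_(s' | z s == z s') 1)); last first.
    rewrite sumr_const ler_nat; exact: hq.
  apply: ler_sum => s' _; rewrite -[leRHS]sum_pweight; apply: ler_sum => f _.
  rewrite -[leRHS]mulr1 ler_wpM2l ?pweight_ge0//.
  rewrite (le_trans (ler_norm _))// normrM mulr_ile1 ?normr_ge0// /y ler_norml.
    by have := v01 s (f (z s)); move=> /andP[? ?]; apply/andP; split; lra.
  by have := v01 s' (f (z s')); move=> /andP[? ?]; apply/andP; split; lra.
apply: (@le_trans _ _ (n%:R^-1 ^+ 2 * (\sum_(s < n) q%:R))).
  by rewrite ler_wpM2l ?sqr_ge0//; apply: ler_sum => s _; apply: step.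
rewrite sumr_const card_ord -[q%:R *+ n]mulr_natl expr2 mulrA -(mulrA n%:R^-1).
by rewrite mulVf ?gt_eqF// mulr1 mulrC.
Qed.

End ProductWeights.

Section Indicator.
Context (R : pzRingType) (X : Type).
Implicit Types (A B : set X).

Lemma indic_asbool A x : \1_A x = (`[< A x >])%:R :> R.
Proof.
by rewrite indicE; case: asboolP => h; [rewrite mem_set|rewrite memNset].
Qed.

End Indicator.

Section RandomMap.
Context (R : realType) (d : measure_display) (X : measurableType d).
Variable mu : probability X R.

Definition separating (S : nat -> set X) :=
  (forall n, measurable (S n)) /\
  (forall x y, x <> y -> exists n, ~ (S n x <-> S n y)).

Definition cell (S : nat -> set X) n (x : X) : {ffun 'I_n -> bool} :=
  [ffun k : 'I_n => `[< S k x >]].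

Lemma cell_dmeas S n : separating S -> dmeas (@cell S n).
Proof. by move=> [mS _]; apply: dmeas_ffun => i; apply: dmeas_bool. Qed.

(** The points where [u] and [v] differ but lie in the same cell of level [n] form sets decreasing
    to the empty set, so continuity of the measure applies. *)
Lemma cell_separates1 S (u v : X -> X) (del : R) : separating S ->
  measurable_fun setT u -> measurable_fun setT v -> 0 < del ->
  exists n, forall m, (n <= m)%N ->
    small mu del (fun x => cell S m (u x) = cell S m (v x) -> u x = v x).
Proof.
move=> hS mu_ mv del0; have [mS sepS] := hS.
pose D k := [set x | ~ (S k (u x) <-> S k (v x))].
have mD k : measurable (D k).
  rewrite (_ : D k = (u @^-1` S k `\` v @^-1` S k) `|` (v @^-1` S k `\` u @^-1` S k)).
    by apply: measurableU; apply: measurableD; apply: measurable_preim.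
  apply/seteqP; split=> x; rewrite /D /=; have := pselect (S k (u x));
  by have := pselect (S k (v x)); tauto.
pose E n := (\bigcup_k D k) `\` (\bigcup_(k in `I_n) D k).
have mE n : measurable (E n).
  by apply: measurableD; apply: bigcup_measurable.
have E0 : \bigcap_n E n = set0.
  apply/seteqP; split=> x // h; have [[k _ Dk] _] := h 0%N I.
  by have [_] := h k.+1 I; apply; exists k => /=.
have : mu \o E @ \oo --> mu (\bigcap_n E n).
  apply: nonincreasing_cvg_mu => //; first by
    rewrite (le_lt_trans (probability_le1 _ _))// ltry.
  - by rewrite E0; apply: measurable0.
  - move=> n m nm; apply/subsetPset => x [Dx nD]; split=> // -[k /= kn Dk].
    by apply: nD; exists k => //=; apply: leq_trans nm.
rewrite E0 measure0 => /fine_cvgP[_ /cvgrPdist_lt/(_ _ del0)[n _ hn]].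
exists n => m nm; exists (E m); split=> //.
  have := hn m nm; rewrite /= sub0r normrN => /ltW; apply: le_trans.
  exact: ler_norm.
move=> x nE uv; apply: contrapT => /sepS [k Dk]; apply: nE; split.
  by exists k.
case=> j /= jm; apply.
have /ffunP/(_ (Ordinal jm)) := uv; rewrite !ffunE /= => h.
by split=> /asboolP; [rewrite h|rewrite -h] => /asboolP.
Qed.

Lemma cell_separates S (I : finType) (u : I -> X -> X) (del : R) : separating S ->
  (forall i, measurable_fun setT (u i)) -> 0 < del ->
  exists n, small mu del
    (fun x => forall i j, cell S n (u i x) = cell S n (u j x) -> u i x = u j x).
Proof.
(* Each pair of indices receives an equal share of [del]; the successor keeps the denominator
   positive when [I] is empty. *)
move=> hS mu_ del0; pose e := del / (#|{: I * I}|.+1)%:R.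
have e0 : 0 < e by rewrite divr_gt0// ltr0n.
have [n hn] := choice (fun ij : I * I =>
  cell_separates1 hS (mu_ ij.1) (mu_ ij.2) e0).
pose m := (\max_ij n ij)%N; exists m.
have h ij : small mu e (fun x => cell S m (u ij.1 x) = cell S m (u ij.2 x) ->
    u ij.1 x = u ij.2 x).
  by apply: hn; apply: leq_bigmax.
apply: small_le (small_imp _ (small_all h)).
  rewrite sumr_const -[e *+ _]mulr_natl /e mulrA ler_pdivrMr ?ltr0n//.
  by rewrite mulrC ler_wpM2l ?ler_nat// ltW.
by move=> x hx i j; apply: (hx (i, j)).
Qed.

Lemma pr_dmeas (T : finType) (q : X -> T) (P : pred T) : dmeas q ->
  pr mu [set x | P (q x)] = \sum_t pr mu [set x | q x = t] * (P t)%:R.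
Proof.
move=> mq; rewrite -(Ex_indic mu (mq (fun t => P t))).
transitivity (Ex mu (fun x => \sum_t (P t)%:R * \1_[set x | q x = t] x)).
  congr (Ex mu _); apply/funext => x; rewrite (bigD1 (q x))//= big1 ?addr0.
    by rewrite [in RHS]indicE [in RHS]mem_set// mulr1 indic_asbool asboolb.
  by move=> t tq; rewrite indicE memNset ?mulr0// => /= /esym /eqP; apply/negP.
rewrite Ex_sum; last by move=> t; apply/bmZ/bm_indic; apply: (mq [set t]).
apply: eq_bigr => t _; rewrite ExZ ?Ex_indic 1?mulrC//; first exact: (mq [set t]).
by apply/bm_indic; apply: (mq [set t]).
Qed.

Lemma prob_inhabited : exists x : X, True.
Proof.
apply: contrapT => h; have := prT mu.
rewrite (_ : setT = set0) ?pr0; first by move/eqP; rewrite eq_sym oner_eq0.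
by apply/seteqP; split=> x // _; apply: h; exists x.
Qed.

(** A representative of each atom of the algebra generated by the [B l], weighted by the measure of
    the atom, is indistinguishable from a [mu]-random point by the sets [B l]. *)
Lemma finite_sampling (L : finType) (B : L -> set X) :
  (forall l, measurable (B l)) ->
  exists (W : finType) (w : W -> R) (rep : W -> X),
    [/\ forall o, 0 <= w o, \sum_o w o = 1 &
        forall l, \sum_o w o * (`[< B l (rep o) >])%:R = pr mu (B l)].
Proof.
move=> mB; pose pat x := [ffun l => `[< B l x >]].
have mpat : dmeas pat by apply: dmeas_ffun => l; apply: dmeas_bool.
have [x0 _] := prob_inhabited.
have /choice[rep hrep] : forall o : {ffun L -> bool}, exists y,
    (exists x, pat x = o) -> pat y = o.
  move=> o.
  by have [[x hx]|h] := pselect (exists x, pat x = o); [exists x|exists x0].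
exists {ffun L -> bool}, (fun o => pr mu [set x | pat x = o]), rep; split.
- by move=> o; apply: pr_ge0.
- have := pr_dmeas predT mpat; under eq_bigr do rewrite mulr1.
  by move=> <-; rewrite (_ : [set _ | _] = setT) ?prT//; apply/seteqP; split.
move=> l; rewrite (_ : B l = [set x | pat x l]); last first.
  by apply/seteqP; split=> x /=; rewrite ffunE => /asboolP.
rewrite (pr_dmeas (fun t : {ffun L -> bool} => t l) mpat); apply: eq_bigr => o _.
have [h|h] := pselect (exists x, pat x = o).
  by rewrite /= hrep// asboolb.
(* An empty atom has the default representative [x0], which is harmless because its weight
   vanishes. *)
rewrite (_ : [set _ | _] = set0) ?pr0 ?mul0r//.
by apply/seteqP; split=> x //= hx; apply: h; exists x.
Qed.

(* [Y] sends the cells of a fine partition to independent samples of a finite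
   approximation of [mu].  The windows [c t s x] and [c t s' x] contribute
   independently unless they coincide, whence the bound on the variance. *)
Theorem random_map S (L T : finType) (B : L -> set X) (k q : nat)
    (c : T -> 'I_k -> X -> X) (r : T -> 'I_k -> X -> L) (p : T -> R) (del : R) :
  separating S -> (forall l, measurable (B l)) -> (0 < k)%N ->
  (forall t s, measurable_fun setT (c t s)) -> (forall t s, dmeas (r t s)) ->
  (forall t s x, pr mu (B (r t s x)) = p t) ->
  (forall t, ae_prop mu (fun x => forall s,
    #|[pred s' | `[< c t s x = c t s' x >]]| <= q)%N) ->
  0 < del -> q%:R <= del * k%:R ->
  exists Y : X -> X, dmeas Y /\ forall t,
    Ex mu (fun x => (k%:R^-1 *
       (\sum_s \1_[set x | B (r t s x) (Y (c t s x))] x) - p t) ^+ 2)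
    <= #|T|%:R * (del + del).
Proof.
move=> hS mB k0 mc mr hp hq del0 qk; have [mS sepS] := hS.
have kR : 0 < k%:R :> R by rewrite ltr0n.
have [W [w [rep [w0 w1 hw]]]] := finite_sampling mB.
pose I := (T * 'I_k)%type.
have [n hn] := cell_separates (u := fun i : I => c i.1 i.2) hS
  (fun i => mc i.1 i.2) del0.
have {}hq : small mu 0 (fun x => forall t s,
    (#|[pred s' | `[< c t s x = c t s' x >]]| <= q)%N).
  by apply: small_le (small_all (fun t => (small_ae mu _).1 (hq t))); rewrite big1.
have [E [mE hE nE]] := small_and hn hq; rewrite addr0 in hE.
pose K := {ffun 'I_n -> bool}.
pose Y (f : {ffun K -> W}) x := rep (f (cell S n x)).
have mY f : dmeas (Y f) by apply: (dmeas_comp (rep \o f)); apply: cell_dmeas.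
pose A f t s := [set x | B (r t s x) (Y f (c t s x))].
have mA f t s : measurable (A f t s).
  rewrite (_ : A f t s = \bigcup_(l in [set: L])
      ([set x | r t s x = l] `&` c t s @^-1` (Y f @^-1` B l))).
    apply: fin_bigcup_measurable => // l _; apply: measurableI.
      exact: (mr t s [set l]).
    by apply: measurable_preim => //; apply: mY.
  by apply/seteqP; split=> x /=; [exists (r t s x)|case=> l _ [/= <-]].
pose g f t x := (k%:R^-1 * (\sum_s \1_(A f t s) x) - p t) ^+ 2.
have bg f t : bm (g f t).
  have h : bm (fun x => k%:R^-1 * (\sum_s \1_(A f t s) x) - p t).
    apply: bmD; last exact: bm_cst.
    by apply/bmZ/bm_sum => s; apply: bm_indic.
  rewrite (_ : g f t = fun x => (k%:R^-1 * (\sum_s \1_(A f t s) x) - p t) *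
    (k%:R^-1 * (\sum_s \1_(A f t s) x) - p t)); first exact: bmM.
  by apply/funext => x; rewrite /g expr2.
have g0 f t x : 0 <= g f t x by apply: sqr_ge0.
have p01 t : 0 <= p t <= 1.
  have [x _] := prob_inhabited; rewrite -(hp t (Ordinal k0) x) pr_ge0 /=.
  by rewrite -(prT mu); apply: le_pr.
have g1 f t x : g f t x <= 1.
  have [p0 p1] := andP (p01 t).
  have s0 : 0 <= \sum_s \1_(A f t s) x :> R by apply: sumr_ge0 => s _; rewrite indicE.
  have s1 : \sum_s \1_(A f t s) x <= k%:R :> R.
    apply: (@le_trans _ _ (\sum_(s < k) 1)); last by rewrite sumr_const card_ord.
    by apply: ler_sum => s _; rewrite indicE; case: (_ \in _).
  have u0 : 0 <= k%:R^-1 * \sum_s \1_(A f t s) x :> R.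
    by rewrite mulr_ge0// invr_ge0 ltW.
  have u1 : k%:R^-1 * \sum_s \1_(A f t s) x <= 1 :> R.
    by rewrite mulrC ler_pdivrMr// mul1r.
  by rewrite /g; move: u0 u1 => /=; set u := _ * _; nra.
have pt t x : ~ E x -> \sum_f pweight w f * g f t x <= del.
  move=> /nE [sep cnt].
  apply: le_trans (_ : q%:R / k%:R <= del); last by rewrite ler_pdivrMr.
  pose v s o : R := (`[< B (r t s x) (rep o) >])%:R.
  have v01 s o : 0 <= v s o <= 1 by rewrite /v; case: asboolP => _; rewrite ?lexx ler01.
  have vp s : \sum_o w o * v s o = p t by rewrite hw hp.
  (* Off [E] the cells of two sample points agree only if the points do, so [q] bounds the number of
     equal coordinates. *)
  have card s : (#|[pred s' | cell S n (c t s x) == cell S n (c t s' x)]| <= q)%N.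
    apply: leq_trans (cnt t s); apply/subset_leq_card/fintype.subsetP => s'.
    rewrite !inE => /eqP e.
    have := sep (t, s) (t, s') e; move=> /= h; by do 2 apply/asboolP.
  have := @mean_variance R K W w w0 w1 k q _ v (p t) k0 (p01 t) v01 vp card.
  apply: le_trans; rewrite le_eqVlt; apply/orP; left; apply/eqP.
  by apply: eq_bigr => f _; rewrite /g; congr (_ * (_ * _ - _) ^+ 2).
(* One [del] is the variance off [E]; the other is the measure of [E], where only the trivial bound
   [1] is available. *)
have Et t : \sum_f pweight w f * Ex mu (g f t) <= del + del.
  under eq_bigr => f _ do rewrite -ExZ//.
  rewrite -Ex_sum; last by move=> f; apply: bmZ.
  apply: (@le_trans _ _ (Ex mu (fun x => del + \1_E x))).
    apply: le_Ex.
    - by apply: bm_sum => f; apply: bmZ.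
    - by apply: bmD; [exact: bm_cst|exact: bm_indic].
    move=> x; have [Ex|/(pt t x)] := pselect (E x); last first.
      by move/le_trans; apply; rewrite lerDl indicE.
    rewrite indicE mem_set//=; apply: (@le_trans _ _ 1); last by rewrite lerDr ltW.
    rewrite -[leRHS](sum_pweight K w1); apply: ler_sum => f _.
    by rewrite -[leRHS]mulr1 ler_wpM2l// pweight_ge0.
  by rewrite ExD ?Ex_cst ?Ex_indic ?lerD//; [exact: bm_cst|exact: bm_indic].
(* A single [f] must serve every [t], so the mean of the sum over [T] is bounded; this produces the
   factor [#|T|]. *)
have [f hf] : exists f, \sum_t Ex mu (g f t) <= #|T|%:R * (del + del).
  apply: (exists_le_mean (pweight_ge0 w0) (sum_pweight K w1)).
  under eq_bigr => f _ do rewrite mulr_sumr.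
  rewrite exchange_big /= mulr_natl -sumr_const; apply: ler_sum => t _; exact: Et.
have Eg0 t : 0 <= Ex mu (g f t).
  by rewrite -(Ex_cst mu 0); apply: le_Ex => //; apply: bm_cst.
exists (Y f); split; first exact: mY.
move=> t; apply: le_trans hf; rewrite (bigD1 t)//= lerDl.
by apply: sumr_ge0 => t' _.
Qed.

(** On an invariant set the translates of [Q] have the same measure as [Q], so the difference to be
    bounded is the integral over [Z] of the deviation of the orbit average from [p], which has small
    variance. *)
Lemma equidistributed (G : group) (a : G -> X -> X) (k : nat) (F : 'I_k -> G)
    (Q : set X) (p eta eps : R) :
  act mu a -> (0 < k)%N -> measurable Q -> 0 < eps ->
  Ex mu (fun x => (k%:R^-1 * (\sum_s \1_Q (a (F s) x)) - p) ^+ 2) <= eta ->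
  forall Z, measurable Z -> invariant a Z ->
    `|pr mu (Q `&` Z) - p * pr mu Z| <= eps + eta / eps.
Proof.
move=> ha k0 mQ eps0 heta Z mZ iZ; case: (ha) => ma mua _ _.
have kR : 0 < k%:R :> R by rewrite ltr0n.
pose u x := k%:R^-1 * (\sum_s \1_Q (a (F s) x)) : R.
have bQ s : bm (fun x => \1_Q (a (F s) x) : R).
  rewrite (_ : (fun _ => _) = \1_(a (F s) @^-1` Q)).
    by apply: bm_indic; apply: measurable_preim.
  by apply/funext => x; rewrite !indicE; congr (_%:R); apply/idP/idP; rewrite !inE.
have bu : bm u by apply/bmZ/bm_sum.
have bZ : bm (\1_Z : X -> R) by apply: bm_indic.
have bv : bm (fun x => (u x - p) ^+ 2).
  rewrite (_ : (fun _ => _) = fun x => (u x + - p) * (u x + - p)).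
    by apply: bmM; apply: bmD => //; apply: bm_cst.
  by apply/funext => x; rewrite expr2.
have EZu : Ex mu (fun x => \1_Z x * u x) = pr mu (Q `&` Z).
  rewrite (_ : (fun _ => _) = fun x => k%:R^-1 * \sum_s \1_Z x * \1_Q (a (F s) x)).
    rewrite ExZ; last by apply: bm_sum => s; apply: bmM.
    rewrite Ex_sum; last by move=> s; apply: bmM.
    rewrite (eq_bigr (fun _ => pr mu (Q `&` Z))) ?sumr_const ?card_ord.
      by rewrite -[pr _ _ *+ k]mulr_natl mulrA mulVf ?mul1r// gt_eqF.
    move=> s _; rewrite (_ : (fun _ => _) = \1_(a (F s) @^-1` (Q `&` Z))).
      rewrite Ex_indic /pr ?mua//; first exact: measurableI.
      by apply: measurable_preim => //; exact: measurableI.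
    apply/funext => x; rewrite !indic_asbool -natrM mulnb -asbool_and.
    have e : (Z x /\ Q (a (F s) x)) <-> (a (F s) @^-1` (Q `&` Z)) x.
      by have := invariantE ha (F s) x iZ; rewrite /preimage /=; tauto.
    by rewrite (asbool_equiv_eq e).
  by apply/funext => x; rewrite /u mulrCA mulr_sumr.
have Ecore (f : X -> R) : bm f ->
    (forall x, \1_Z x * f x <= eps + eps^-1 * (u x - p) ^+ 2) ->
    Ex mu (fun x => \1_Z x * f x) <= eps + eta / eps.
  move=> bf hf; apply: (@le_trans _ _ (Ex mu (fun x => eps + eps^-1 * (u x - p) ^+ 2))).
    apply: le_Ex => //; first exact: bmM.
    by apply: bmD; [exact: bm_cst|exact: bmZ].
  rewrite ExD ?Ex_cst ?ExZ//; [|exact: bm_cst|exact: bmZ].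
  by rewrite lerD2l mulrC ler_wpM2r// invr_ge0 ltW.
(* AM-GM turns the bound on the variance into a bound on the mean deviation. *)
have AG (z : R) : `|z| <= eps + eps^-1 * z ^+ 2.
  rewrite -real_normK ?num_real//; move: (normr_ge0 z); move: `|z| => y y0.
  rewrite -(ler_pM2l eps0) mulrDr mulrA mulfV ?gt_eqF// mul1r; nra.
have Z01 x (z : R) : \1_Z x * z <= `|z|.
  by rewrite indicE; case: (_ \in _); rewrite ?mul1r ?mul0r// ler_norm.
have bp c : bm (fun=> c : R) := @bm_cst _ _ X c.
rewrite ler_norml -EZu -(Ex_indic mu mZ) -ExZ//.
have eB : Ex mu (fun x => \1_Z x * (u x - p)) =
    Ex mu (fun x => \1_Z x * u x) - Ex mu (fun x => p * \1_Z x).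
  rewrite (_ : (fun x => \1_Z x * (u x - p)) =
    fun x => \1_Z x * u x + - 1 * (p * \1_Z x)).
    by rewrite ExD ?[Ex mu (fun x => -1 * _)]ExZ ?mulN1r//;
      [exact: bmZ|exact: bmM|do 2 apply: bmZ].
  by apply/funext => x; ring.
have eB' : Ex mu (fun x => \1_Z x * (p - u x)) =
    Ex mu (fun x => p * \1_Z x) - Ex mu (fun x => \1_Z x * u x).
  rewrite (_ : (fun x => \1_Z x * (p - u x)) =
    fun x => p * \1_Z x + - 1 * (\1_Z x * u x)).
    by rewrite ExD ?[Ex mu (fun x => -1 * _)]ExZ ?mulN1r//;
      [exact: bmM|exact: bmZ|apply: bmZ; exact: bmM].
  by apply/funext => x; ring.
have h1 := Ecore (fun x => u x - p) (bmD bu (bp (- p)))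
  (fun x => le_trans (Z01 x _) (AG _)).
have h2 : Ex mu (fun x => \1_Z x * (p - u x)) <= eps + eta / eps.
  apply: Ecore => [|x].
    rewrite (_ : (fun _ => _) = fun x => p + -1 * u x).
      by apply: bmD => //; apply: bmZ.
    by apply/funext => x; rewrite mulN1r.
  by rewrite -sqrrN opprB; apply: le_trans (Z01 x _) (AG _).
by rewrite eB in h1; rewrite eB' in h2; apply/andP; split; lra.
Qed.

End RandomMap.

(** * Almost invariant sets in abelian groups *)

Section Folner.
Variable A : group.
Hypothesis abA : abelian_group A.

Fixpoint gexp (k : A) (n : nat) : A :=
  if n is n'.+1 then gmul k (gexp k n') else gone A.

(** Products of powers of the elements of [K] with exponents below [n]. Repetitions are kept, so the
    length is an exact power and bounds the number of distinct elements. *)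
Fixpoint box (K : seq A) (n : nat) : seq A :=
  if K is k :: K' then
    [seq gmul (gexp k i) h | i <- iota 0 n, h <- box K' n]
  else [:: gone A].

Lemma size_box K n : size (box K n) = (n ^ size K)%N.
Proof. by elim: K => //= k K ih; rewrite size_allpairs size_iota ih expnS. Qed.

Lemma box_mono K n m : (n <= m)%N -> {subset box K n <= box K m}.
Proof.
move=> nm; elim: K => //= k K ih x /allpairsP[[i h] /= [Hi Hh ->]].
apply/allpairsP; exists (i, h); split=> //=; last exact: ih.
by move: Hi; rewrite !mem_iota !add0n => /andP[_ /leq_trans]; apply.
Qed.

Lemma box_mul K n a x : a \in K -> x \in box K n -> gmul x a \in box K n.+1.
Proof.
elim: K x => [//|k K ih x]; rewrite in_cons => /orP[/eqP ->|aK];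
  move=> /allpairsP[[i h] [Hi Hh ->]]; apply/allpairsP; move: Hi Hh => /= Hi Hh;
  have [i1 i0] : i.+1 \in iota 0 n.+1 /\ i \in iota 0 n.+1 by
    move: Hi; rewrite !mem_iota !add0n !ltnS /= => ii; rewrite ii (ltnW ii).
- exists (i.+1, h); split=> /=.
  + exact: i1.
  + exact: box_mono Hh.
  + by rewrite abA gmulA.
- exists (i, gmul h a); split=> /=.
  + exact: i0.
  + exact: ih.
  + by rewrite gmulA.
Qed.

Lemma box_neq0 K n : gone A \in box K n.+1.
Proof.
elim: K => [|k K ih]; first by rewrite mem_seq1.
by apply/allpairsP; exists (0%N, gone A); split; rewrite //= gmul1.
Qed.

Lemma bernoulli_ineq (R : realFieldType) (e : R) n : 0 <= e ->
  1 + n%:R * e <= (1 + e) ^+ n.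
Proof.
move=> e0; elim: n => [|n ih]; first by rewrite mul0r addr0 expr0.
rewrite exprS -natr1; have n0 : 0 <= n%:R :> R by [].
apply: le_trans (ler_wpM2l _ ih); last by lra.
have : 0 <= e * (n%:R * e) by rewrite !mulr_ge0.
by lra.
Qed.

(** For exponent [m * r.+1], Bernoulli's inequality bounds the right side below by the power [r.+1]
    of [m * e], of degree [r.+1] in [m], whereas the left side is at most the power [r] of
    [m * r.+2]. A large [m] decides. *)
Lemma exp_beats_poly (R : archiRealFieldType) (e : R) r : 0 < e ->
  exists n, n.+1%:R ^+ r < (1 + e) ^+ n.
Proof.
move=> e0; pose m := (Num.truncn ((r.+2%:R ^+ r) / e ^+ r.+1)).+1.
have hm : r.+2%:R ^+ r < m%:R * e ^+ r.+1.
  by rewrite -ltr_pdivrMr ?exprn_gt0// /m truncnS_gt.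
exists (m * r.+1)%N; rewrite exprM.
apply: (@lt_le_trans _ _ ((m%:R * e) ^+ r.+1)); last first.
  have e0' := ltW e0; have le1 : m%:R * e <= (1 + e) ^+ m.
    by apply: le_trans (bernoulli_ineq m e0'); rewrite lerDr.
  by apply: lerXn2r; rewrite // nnegrE ?exprn_ge0 ?mulr_ge0 ?addr_ge0.
apply: (@le_lt_trans _ _ ((m%:R * r.+2%:R) ^+ r)).
  apply: lerXn2r; rewrite ?nnegrE ?mulr_ge0// -natrM ler_nat.
  by rewrite (mulnS _ r.+1) -add1n leq_add2r.
rewrite !exprMn exprS -mulrA mulrCA ltr_pM2l ?exprn_gt0 ?ltr0n//.
Qed.

(* The boxes grow polynomially, hence not by a factor [1 + eps] at each step. *)
Lemma folner (R : archiRealFieldType) (K : seq A) (eps : R) : 0 < eps ->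
  exists D : seq A, [/\ uniq D, D != [::] &
    forall a, a \in K ->
      (count (fun d => gmul d a \notin D) D)%:R <= eps * (size D)%:R].
Proof.
move=> e0; pose D n := undup (box K n).
pose s n := size (D n).
have sle n : (s n <= n ^ size K)%N by rewrite -size_box size_undup.
have s1 n : (0 < s n.+1)%N.
  by rewrite lt0n size_eq0; apply/eqP => D0;
    have := box_neq0 K n; rewrite -mem_undup -/(D n.+1) D0.
have [n hn] : exists n, (s n.+2)%:R <= (1 + eps) * (s n.+1)%:R.
  apply: contrapT => /forallNP h.
  have {}h n : (1 + eps) * (s n.+1)%:R <= (s n.+2)%:R.
    by have /negP := h n; rewrite -ltNge => /ltW.
  have g n : (1 + eps) ^+ n <= (s n.+1)%:R.
    elim: n => [|n ih]; first by rewrite expr0 ler1n.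
    apply: le_trans (h n); rewrite exprS ler_wpM2l// addr_ge0// ltW//.
  have [n] := exp_beats_poly (size K) e0.
  rewrite ltNge => /negP; apply; apply: le_trans (g n) _.
  by rewrite -natrX ler_nat.
exists (D n.+1); split; first exact: undup_uniq.
  by rewrite -size_eq0 -lt0n; apply: s1.
move=> a aK; set p := (fun d => _).
(* The translates by [a] that leave [D n.+1] are pairwise distinct, and together with [D n.+1] they
   fit into the next box. *)
have : (s n.+1 + count p (D n.+1) <= s n.+2)%N.
  rewrite -size_filter -(size_map (fun d => gmul d a)) -size_cat.
  apply: uniq_leq_size.
    rewrite cat_uniq undup_uniq map_inj_uniq ?filter_uniq ?undup_uniq ?andbT//=.
      by apply/hasPn => x /mapP[d]; rewrite mem_filter => /andP[pd _] ->.
    by move=> x y; apply: gmulIr.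
  move=> x; rewrite mem_cat mem_undup [in X in _ || X]/D => /orP[|/mapP[d]].
    by rewrite mem_undup; apply: box_mono.
  by rewrite mem_filter !mem_undup => /andP[_ dD] ->; apply: box_mul.
by rewrite -(ler_nat R) natrD -/(s n.+1); lra.
Qed.

End Folner.

(** * The location of the minimum of randomly permuted labels *)

Section ArgMin.
Variables (K : finType) (rk : K -> nat).
Hypothesis rk_inj : injective rk.

Definition minimal_at (C : {set K}) (s : {perm K}) (u : K) :=
  [forall k in C, rk (s u) <= rk (s k)]%N.

(* Exchanging the labels of two points of C shows that each point of C is
   equally likely to carry the minimal label. *)
Lemma argmin_count (C B : {set K}) : B \subset C ->
  (#|[set s : {perm K} | [exists u in B, minimal_at C s u]]%SET| * #|C|
    <= #|B| * #|{perm K}|)%N.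
Proof.
move=> BC; pose M u := [set s : {perm K} | minimal_at C s u]%SET.
have Meq u v : u \in C -> v \in C -> (#|M u| <= #|M v|)%N.
  move=> uC vC; 
  pose f (s : {perm K}) := perm (inj_comp (@perm_inj _ s) (@perm_inj _ (tperm u v))).
  have fE s k : f s k = s (tperm u v k) by rewrite permE.
  have f_inj : injective f.
    by move=> s t st; apply/permP => k; rewrite -(tpermK u v k) -!fE st.
  rewrite -(card_imset (mem (M u)) f_inj).
  apply/subset_leq_card/fintype.subsetP => _ /imsetP[s + ->].
  rewrite !inE => /'forall_implyP h; apply/'forall_implyP => k kC.
  rewrite !fE tpermR; apply: h.
  by case: tpermP => // ->.
(* Injectivity of [rk] makes the minimum unique, so the sets [M v] for [v] in [C] are disjoint, and
   by [Meq] they have equal size. *)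
have Mb u : u \in C -> (#|M u| * #|C| <= #|{perm K}|)%N.
  move=> uC; rewrite mulnC -sum_nat_const.
  apply: (@leq_trans (\sum_(v in C) #|M v|)); first by apply: leq_sum => v; exact: Meq.
  under eq_bigr => v _ do rewrite -sum1_card.
  rewrite (exchange_big_dep predT)//= -[leqRHS]sum1_card; apply: leq_sum => s _.
  rewrite sum1_card; apply/card_le1_eqP => v w.
  move=> /andP[vC]; rewrite inE => /'forall_implyP hv.
  move=> /andP[wC]; rewrite inE => /'forall_implyP hw.
  have := hv w wC; have := hw v vC => h1 h2.
  by apply: (@perm_inj _ s); apply: rk_inj; apply/eqP; rewrite eqn_leq h1 h2.
apply: (@leq_trans ((\sum_(u in B) #|M u|) * #|C|)); last first.
  rewrite big_distrl /= -sum_nat_const; apply: leq_sum => u uB.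
  by apply: Mb; apply: (fintype.subsetP BC).
rewrite leq_mul2r; apply/orP; right.
rewrite (_ : [set s | _]%SET = (\bigcup_(u in B) M u)%SET); last first.
  apply/setP => s; rewrite inE; apply/idP/bigcupP.
    by move=> /exists_inP[u uB us]; exists u; rewrite ?inE.
  by move=> [u uB]; rewrite inE => us; apply/exists_inP; exists u.
elim/big_rec2: _ => [|u n S _ h]; first by rewrite cards0.
by rewrite (leq_trans (leq_card_setU _ _))// leq_add2l.
Qed.

End ArgMin.

(** * Approximately equivariant choices and maps *)

Section Model.
Context (R : realType) (d : measure_display) (X : measurableType d).
Variable mu : probability X R.

Lemma measurable_eq_fun (S : nat -> set X) (u v : X -> X) : separating S ->
  measurable_fun setT u -> measurable_fun setT v ->
  measurable [set x | u x = v x].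
Proof.
move=> [mS sepS] mu_ mv.
rewrite (_ : [set _ | _] = \bigcap_k ~` ((u @^-1` S k `\` v @^-1` S k) `|`
   (v @^-1` S k `\` u @^-1` S k))).
  apply: bigcap_measurable => // k _; apply: measurableC.
  by apply: measurableU; apply: measurableD; apply: measurable_preim.
apply/seteqP; split=> x /=.
  by move=> uv k _ /=; rewrite uv => -[[]|[]].
move=> h; apply: contrapT => /sepS [k]; have := h k I => /=.
have := pselect (S k (u x)); have := pselect (S k (v x)); tauto.
Qed.

Section AbelianAction.
Variable A : group.
Hypothesis abA : abelian_group A.
Variable a : A -> X -> X.
Hypothesis ha : act mu a.
Hypothesis fa : ess_free mu a.

Lemma free_eq : ae_prop mu (fun x => forall g h, a g x = a h x -> g = h).
Proof.
case: ha => _ _ a1 aM; case: fa => N [mN N0 hN]; exists N; split=> // x Nx g h gh.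
apply: contrapT => ngh; apply: (hN x Nx (gmul (ginv h) g)).
  by move=> e; apply: ngh; apply: (@gmulI _ (ginv h)); rewrite e gmulV.
by rewrite aM gh -aM gmulV a1.
Qed.

(* [D (i x)] picks the translate of [x] whose cell carries the smallest label.
   When [D] is almost invariant and the labels are permuted at random, [x] and
   [a g x] mostly pick the same point of their orbit. *)
Lemma equivariant_choice (S : nat -> set X) (K : seq A) (eps : R) :
  separating S -> 0 < eps ->
  exists (m : nat) (D : 'I_m -> A) (i : X -> 'I_m), dmeas i /\
    forall g, g \in K ->
      small mu eps (fun x => D (i x) = gmul (D (i (a g x))) g).
Proof.
move=> hS eps0; case: (ha) => ma mua a1 aM.
(* For one [g] the mean measure of the bad set is at most [3 * e1]: two shares for the boundary of
   [D] and one for the set [E] where cells do not separate. One permutation has to work for all of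
   [K], so these bounds are summed over [K]. *)
pose e1 : R := eps / (4 * (size K).+1%:R).
have K0 : 0 < (size K).+1%:R :> R by rewrite ltr0n.
have e10 : 0 < e1 by rewrite divr_gt0// mulr_gt0.
have [D [uD D0 hD]] := folner abA K e10.
have i0 : 'I_(size D) by case: (D) D0 => // x s _; exact: ord0.
(* All group elements whose translates of a point are compared; the partition into cells has to
   separate these translates. *)
pose U := undup (D ++ [seq gmul dg.1 dg.2 | dg <- [seq (dd, g) | dd <- D, g <- K]]).
have inD x : x \in D -> x \in U by rewrite mem_undup mem_cat => ->.
have inDK x g : x \in D -> g \in K -> gmul x g \in U.
  move=> xD gK; rewrite mem_undup mem_cat; apply/orP; right.
  by apply/mapP; exists (x, g) => //; apply/allpairsP; exists (x, g).
have [n hn] := @cell_separates _ _ _ mu _ _ (fun j : 'I_(size U) => a (nth (gone A) U j)) _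
  hS (fun j => ma _) e10.
have [E [mE hE nE]] := small_and hn ((small_ae mu _).1 free_eq); rewrite addr0 in hE.
have {}nE x : ~ E x -> forall g h, g \in U -> h \in U ->
    cell S n (a g x) = cell S n (a h x) -> g = h.
  move=> /nE [sep fr] g h gU hU gh; apply: fr.
  have gi : (index g U < size U)%N by rewrite index_mem.
  have hi : (index h U < size U)%N by rewrite index_mem.
  have := sep (Ordinal gi) (Ordinal hi); rewrite /= !nth_index//; exact.
pose C := {ffun 'I_n -> bool}.
pose rk (c : C) : nat := enum_rank c.
have rk_inj : injective rk by move=> c c' /ord_inj /enum_rank_inj.
pose lab (s : {perm C}) g x := rk (s (cell S n (a g x))).
pose phi (s : {perm C}) (t : {ffun 'I_(size D) -> C}) : 'I_(size D) :=
  [arg min_(j < i0) rk (s (t j))].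
pose i s x := phi s [ffun j : 'I_(size D) => cell S n (a (nth (gone A) D j) x)].
have mi s : dmeas (i s).
  apply: (dmeas_comp (phi s)); apply: dmeas_ffun => j.
  by apply: dmeas_fun => //; apply: cell_dmeas.
pose DD (j : 'I_(size D)) := nth (gone A) D j.
have DDin j : DD j \in D by apply: mem_nth.
have imin s x g : g \in D -> (lab s (DD (i s x)) x <= lab s g x)%N.
  move=> gD; rewrite /i /phi; case: arg_minnP => // j _ hj.
  have gi : (index g D < size D)%N by rewrite index_mem.
  by have := hj (Ordinal gi) isT; rewrite !ffunE /= nth_index.
have iuniq s x g : (forall h, h \in D -> cell S n (a g x) = cell S n (a h x) -> g = h) ->
    g \in D -> (forall h, h \in D -> (lab s g x <= lab s h x)%N) -> DD (i s x) = g.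
  move=> sep gD gmin; apply/esym/sep => //.
  apply: (@perm_inj _ s); apply: rk_inj; apply/eqP; rewrite eqn_leq.
  by rewrite -/(lab s g x) -/(lab s (DD (i s x)) x) gmin// imin.
pose bad s g := [set x | DD (i s x) <> gmul (DD (i s (a g x))) g].
have mbad s g : measurable (bad s g).
  rewrite (_ : bad s g = \bigcup_(j in [set: 'I_(size D)]) ([set x | i s x = j] `&`
     (a g @^-1` (i s @^-1` [set j' | DD j <> gmul (DD j') g])))).
    apply: fin_bigcup_measurable => // j _; apply: measurableI.
      exact: (mi s [set j]).
    by apply: measurable_preim => //; apply: mi.
  by apply/seteqP; split=> x /=; [exists (i s x)|case=> j _ [/= <-]].
pose N := #|{perm C}|.
have N0 : (0 < N)%N by apply/card_gt0P; exists (perm (@inj_id C)).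
have NR : 0 < N%:R :> R by rewrite ltr0n.
have pt g x : g \in K -> ~ E x ->
    \sum_(s : {perm C}) N%:R^-1 * \1_(bad s g) x <= e1 + e1 :> R.
  move=> gK /nE sep.
  pose Dg := [seq gmul dd g | dd <- D].
  (* The candidates of [x] are its translates by [D], those of [a g x] are the translates of [x] by
     [Dg]. If the least label over the union [V] is attained in both, both points pick it; a
     disagreement forces the minimum into the symmetric difference [B]. *)
  pose V := undup (D ++ Dg); pose B := [seq v <- V | ~~ ((v \in D) && (v \in Dg))].
  have VU v : v \in V -> v \in U.
    by rewrite mem_undup mem_cat => /orP[/inD//|/mapP[dd ddD ->]]; apply: inDK.
  pose cl v := cell S n (a v x).
  have clinj : {in V &, injective cl} by move=> v w /VU vU /VU wU; apply: sep.
  pose CV := [set c in [seq cl v | v <- V]]%SET.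
  pose CB := [set c in [seq cl v | v <- B]]%SET.
  have BV : {subset B <= V} by move=> v; rewrite mem_filter => /andP[].
  have CBV : CB \subset CV.
    apply/fintype.subsetP => c; rewrite !inE => /mapP[v vB ->].
    by apply: map_f; apply: BV.
  have cCV : #|CV| = size V.
    rewrite cardsE (card_uniqP _) ?size_map// map_inj_in_uniq ?undup_uniq//.
  have cCB : (#|CB| <= size B)%N.
    by rewrite cardsE (leq_trans (card_size _))// size_map.
  have sDV : (size D <= size V)%N.
    by apply: uniq_leq_size => // v vD; rewrite mem_undup mem_cat vD.
  (* [D] and [Dg] have equal size, so the two halves of their symmetric difference do too, and each
     is at most [e1 * size D]. *)
  have sB : (size B)%:R <= (e1 + e1) * (size V)%:R :> R.
    pose p := fun dd => gmul dd g \notin D.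
    have hc := hD g gK; rewrite -/p in hc.
    have uDg : uniq Dg by rewrite map_inj_uniq// => u v; apply: gmulIr.
    have c1 : (count [predC D] Dg = count p D)%N by rewrite count_map.
    have c2 : (count [predC Dg] D = count [predC D] Dg)%N.
      apply/eqP; rewrite -(eqn_add2l (count (mem Dg) D)) count_predC.
      have -> : count (mem Dg) D = count (mem D) Dg.
        rewrite -!size_filter; apply/eqP; rewrite eqn_leq; apply/andP; split;
        apply: uniq_leq_size; rewrite ?filter_uniq// => v;
        by rewrite !mem_filter /= andbC.
      by rewrite count_predC size_map.
    have : (size B <= count [predC Dg] D + count [predC D] Dg)%N.
      rewrite -!size_filter -size_cat; apply: uniq_leq_size.
        by rewrite filter_uniq// undup_uniq.
      move=> v; rewrite mem_filter mem_undup mem_cat mem_cat !mem_filter /= negb_and.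
      by case: (v \in D); case: (v \in Dg).
    rewrite c2 c1 -(ler_nat R) natrD => h1.
    have h2 : (size D)%:R <= (size V)%:R :> R by rewrite ler_nat.
    have h3 : e1 * (size D)%:R <= e1 * (size V)%:R by rewrite ler_wpM2l// ltW.
    by apply: le_trans h1 _; rewrite mulrDl; apply: lerD; apply: le_trans h3.
  have sV0 : 0 < (size V)%:R :> R.
    by rewrite ltr0n (leq_trans _ sDV)// lt0n size_eq0.
  have badsub s : bad s g x -> [exists u in CB, minimal_at rk CV s u].
    move=> hb; pose v0 := DD i0.
    have v0V : v0 \in V by rewrite mem_undup mem_cat DDin.
    have [u uV umin] : exists2 u, u \in V &
        forall v, v \in V -> (lab s u x <= lab s v x)%N.
      have [j _ jmin] := @arg_minnP 'I_(size V) (Ordinal (n:=size V)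
        (m:=index v0 V) (etrans (index_mem v0 V) v0V)) xpredT
        (fun j => lab s (nth (gone A) V j) x) isT.
      exists (nth (gone A) V j); first exact: mem_nth.
      move=> v vV; have vi : (index v V < size V)%N by rewrite index_mem.
      by have := jmin (Ordinal vi) isT; rewrite /= nth_index.
    apply/exists_inP; exists (cl u); last first.
      apply/'forall_implyP => c; rewrite inE => /mapP[v vV ->]; exact: umin.
    rewrite inE; apply: map_f; rewrite mem_filter uV andbT; apply/negP.
    move=> /andP[uD' /mapP[u' u'D uu']]; apply: hb.
    have inV v : v \in D -> v \in V by rewrite mem_undup mem_cat => ->.
    have inVg v : v \in D -> gmul v g \in V.
      by move=> vD; rewrite mem_undup mem_cat; apply/orP; right; apply: map_f.
    have -> : DD (i s x) = u.
      apply: iuniq => // [h hD'|h hD']; last by apply/umin/inV.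
      by apply: clinj => //; apply: inV.
    have -> : DD (i s (a g x)) = u'; last by [].
    apply: iuniq => // [h hD'|h hD'].
      rewrite -!aM => e; apply: (@gmulIr _ g); apply: clinj => //; exact: inVg.
    by rewrite /lab -!aM -uu'; apply/umin/inVg.
  rewrite -mulr_sumr mulrC ler_pdivrMr//.
  apply: (@le_trans _ _ (#|[set s : {perm C} | [exists u in CB, minimal_at rk CV s u]]%SET|%:R)).
    rewrite -sum1_card natr_sum [leRHS]big_mkcond /=; apply: ler_sum => s _.
    rewrite indic_asbool inE; case: asboolP => [/badsub ->//|_].
    by case: ifP.
  rewrite -(ler_pM2r sV0) -natrM -cCV.
  apply: (@le_trans _ _ (#|CB| * N)%:R); first by rewrite ler_nat argmin_count.
  rewrite natrM cCV mulrAC ler_wpM2r//; apply: le_trans sB.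
  by rewrite ler_nat.
have mean g : g \in K ->
    \sum_(s : {perm C}) N%:R^-1 * pr mu (bad s g) <= e1 + e1 + e1 :> R.
  move=> gK; have b1 s : bm (\1_(bad s g) : X -> R) by apply: bm_indic.
  under eq_bigr => s _ do rewrite -Ex_indic// -ExZ//.
  rewrite -Ex_sum; last by move=> s; apply: bmZ.
  apply: (@le_trans _ _ (Ex mu (fun x => e1 + e1 + \1_E x))).
    apply: le_Ex.
    - by apply: bm_sum => s; apply: bmZ.
    - by apply: bmD; [exact: bm_cst|exact: bm_indic].
    move=> x; have [Ex|/(pt g x gK)] := pselect (E x); last first.
      by move/le_trans; apply; rewrite lerDl indicE.
    rewrite [\1_E x]indicE mem_set//=; apply: (@le_trans _ _ 1); last first.
      by rewrite lerDr addr_ge0// ltW.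
    rewrite -mulr_sumr mulrC ler_pdivrMr// mul1r /N -sum1_card natr_sum.
    by apply: ler_sum => s _; rewrite indicE; case: (_ \in _).
  rewrite ExD ?Ex_cst ?Ex_indic//; [|exact: bm_cst|exact: bm_indic].
  by rewrite lerD2l.
have W1 : \sum_(s : {perm C}) N%:R^-1 = 1 :> R.
  by rewrite sumr_const -[_ *+ _]mulr_natl mulfV// gt_eqF.
have [s hs] : exists s, \sum_(g <- K) pr mu (bad s g) <= (size K)%:R * (e1 + e1 + e1).
  have W0 (s : {perm C}) : 0 <= N%:R^-1 :> R by rewrite invr_ge0 ltW.
  apply: (exists_le_mean W0 W1).
  under eq_bigr => s _ do rewrite mulr_sumr.
  rewrite exchange_big /= mulr_natl.
  apply: (@le_trans _ _ (\sum_(g <- K) (e1 + e1 + e1))).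
    by rewrite !big_seq; apply: ler_sum => g gK; exact: mean.
  by rewrite big_const_seq count_predT iter_addr addr0.
exists (size D), DD, (i s); split=> // g gK; exists (bad s g); split=> //.
  apply: le_trans (_ : \sum_(g <- K) pr mu (bad s g) <= eps).
    rewrite (big_rem g)//= lerDl; apply: sumr_ge0 => h _; exact: pr_ge0.
  apply: le_trans hs _; rewrite /e1.
  have := @ler_nat R (size K) (size K).+1; rewrite leqnSn.
  set k := (size K)%:R; set k' := (_.+1)%:R => kk.
  have k0 : 0 < k' by [].
  have -> : k * (eps / (4 * k') + eps / (4 * k') + eps / (4 * k')) =
    (k * (3 * eps)) / (4 * k') by field; rewrite gt_eqF.
  rewrite ler_pdivrMr ?mulr_gt0//; have : 0 <= k by [].
  nra.
by move=> x /contrapT.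
Qed.

End AbelianAction.
End Model.

Section Models.
Context (R : realType) (d : measure_display) (X : measurableType d).
Variable mu : probability X R.

Definition equidist (C : finType) (P : X -> C) (G : group) (a : G -> X -> X)
    (eps : R) (Q : X -> C) :=
  forall (Z : set X) (j : C), measurable Z -> invariant a Z ->
    `|pr mu ([set x | Q x = j] `&` Z) - pr mu [set x | P x = j] * pr mu Z| <= eps.

Lemma countably_infinite_enum (A : group) : countably_infinite A ->
  exists e : nat -> A, injective e /\ forall g, exists n, e n = g.
Proof.
move=> [e [f ef fe]]; exists e; split; first exact: can_inj ef.
by move=> g; exists (f g).
Qed.

(** The left side is the error of [equidistributed] at threshold [eps / 2] when the variance is
    bounded as in [random_map] with [c] requirements. Hence [del] is of order [eps ^+ 2]. *)
Lemma scale_bound (c eps : R) : 0 < eps -> 0 <= c ->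
  exists2 del : R, 0 < del & eps / 2 + c * (del + del) / (eps / 2) <= eps.
Proof.
move=> e0 c0; exists (eps ^+ 2 / (8 * (c + 1))).
  by rewrite divr_gt0 ?exprn_gt0// mulr_gt0//; lra.
have c1 : 0 < c + 1 by lra.
have -> : c * (eps ^+ 2 / (8 * (c + 1)) + eps ^+ 2 / (8 * (c + 1))) / (eps / 2) =
   (c / (c + 1)) * (eps / 2) by field; rewrite !gt_eqF.
have : c / (c + 1) <= 1 by rewrite ler_pdivrMr//; lra.
set u := c / _ => u1; nra.
Qed.

(* [phi x] is obtained by transporting, with [b], a random point attached to the
   point [a (D (i x)) x] picked by [x]; equivariance is inherited from the
   coherence of the picks. *)
Lemma approximate_factor (S : nat -> set X) (A : group) (a b : A -> X -> X)
    (C : finType) (P : X -> C) (K : seq A) (eps : R) :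
  separating S -> abelian_group A -> countably_infinite A ->
  act mu a -> ess_free mu a -> act mu b -> dmeas P -> 0 < eps ->
  exists phi : X -> X, [/\ dmeas (P \o phi),
    forall g, g \in K -> small mu eps (fun x => phi (a g x) = b g (phi x)) &
    equidist P a eps (P \o phi)].
Proof.
move=> hS abA /countably_infinite_enum [e [e_inj e_surj]] ha fa hb mP eps0.
case: (ha) => ma mua a1 aM; case: (hb) => mb mub b1 bM.
have [m [D [i [mi hi]]]] := equivariant_choice abA ha fa K hS eps0.
have [del del0 hdel] := scale_bound eps0 (ler0n R #|C|).
pose c x := a (D (i x)) x.
have mc : measurable_fun setT c.
  have [x0 _] := prob_inhabited mu.
  have e' j : exists n, (fun n => odflt (i x0) (unpickle n)) n = j.
    by exists (pickle j); rewrite pickleK.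
  by apply: (measurable_glue e' mi (f := fun j => a (D j))).
(* The length of the orbit sample: up to [m] of its picks may coincide, and the variance bound needs
   this multiplicity to be at most [del * k]. *)
pose k := (Num.truncn (m%:R / del)).+1.
have mk : m%:R <= del * k%:R by rewrite mulrC -ler_pdivrMr// ltW// truncnS_gt.
(* The event that a random point, transported by [b] from a pick of index [l.1], gets colour [l.2].
   As [b] preserves the measure, its probability depends on the colour alone. *)
pose B (l : 'I_m * C) := [set y | P (b (ginv (D l.1)) y) = l.2].
have mB l : measurable (B l).
  by apply: (dmeas_fun (mb (ginv (D l.1))) mP [set l.2]).
have pB l : pr mu (B l) = pr mu [set x | P x = l.2].
  by rewrite /pr -(mub (ginv (D l.1)) _ (mP [set l.2])).
have mce s : measurable_fun setT (c \o a (e s)) by apply: measurableT_comp.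
have dr (j : C) s : dmeas (fun x => (i (a (e s) x), j)).
  by apply: (dmeas_comp (fun u => (u, j))); apply: dmeas_fun => //; apply: ma.
(* By freeness, coinciding picks made with the same index come from the same translate; so at most
   one translate per index can share a given pick. *)
have cnt (j : C) : ae_prop mu (fun x => forall s : 'I_k,
    #|[pred s' : 'I_k | `[< (c \o a (e s)) x = (c \o a (e s')) x >]]| <= m)%N.
  have [N [mN N0 hN]] := free_eq ha fa; exists N; split=> // x /hN fx s.
  rewrite -[leqRHS]card_ord.
  apply: (leq_card_in (fun s' : 'I_k => i (a (e s') x))) => s1 s2.
  rewrite !inE => /asboolP/asboolP /= h1 /asboolP/asboolP /= h2 h12.
  apply/val_inj/e_inj; apply: (@gmulI _ (D (i (a (e s1) x)))).
  apply: fx; rewrite !aM [in RHS]h12.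
  by move: h1 h2; rewrite /c => <- <-.
have [Y [mY hY]] := @random_map _ _ _ mu S _ C B k m
  (fun _ s => c \o a (e s)) (fun j s x => (i (a (e s) x), j))
  (fun j => pr mu [set x | P x = j]) del hS mB isT (fun _ s => mce s)
  (fun j s => dr j s) (fun j s x => pB _) cnt del0 mk.
pose phi x := b (ginv (D (i x))) (Y (c x)).
have mPphi : dmeas (P \o phi).
  apply: dmeas_fin => j; rewrite (_ : [set _ | _] = \bigcup_(l in [set: 'I_m])
     ([set x | i x = l] `&` (c @^-1` (Y @^-1` B (l, j))))).
    apply: fin_bigcup_measurable => // l _; apply: measurableI.
      exact: (mi [set l]).
    by apply: measurable_preim => //; apply: mY.
  by apply/seteqP; split=> x /=; [exists (i x)|case=> l _ [/= <-]].
exists phi; split=> //.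
  move=> g gK; apply: small_imp (hi g gK) => x hx.
  have cc : c (a g x) = c x by rewrite /c -aM -hx.
  by rewrite /phi cc hx ginvM bM (actVK hb).
move=> Z j mZ iZ; apply: le_trans hdel.
apply: (equidistributed (F := fun s : 'I_k => e s) (k := k) ha) => //.
- exact: (mPphi [set j]).
- by rewrite divr_gt0.
- exact: (hY j).
Qed.

(** [Q] is [P] composed with a random map. Freeness makes the sample points along each orbit
    distinct, so the multiplicity is [1]; indexing the requirements by [T * C] yields one [Q] for
    all actions and colours. *)
Lemma equidistributed_colouring (S : nat -> set X) (T : finType)
    (A : T -> group) (a : forall t, A t -> X -> X) (C : finType) (P : X -> C)
    (eps : R) :
  separating S -> (forall t, countably_infinite (A t)) ->
  (forall t, act mu (a t)) -> (forall t, ess_free mu (a t)) ->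
  dmeas P -> 0 < eps ->
  exists Q : X -> C, dmeas Q /\ forall t, equidist P (a t) eps Q.
Proof.
move=> hS hA ha fa mP eps0.
have /all_sig [e he] : forall t, {e : nat -> A t | injective e}.
  by move=> t; apply: cid; have [e [? _]] := countably_infinite_enum (hA t); exists e.
have [del del0 hdel] := scale_bound eps0 (ler0n R #|{: T * C}|).
pose k := (Num.truncn (1 / del)).+1.
have mk : 1%:R <= del * k%:R by rewrite mulrC -ler_pdivrMr// ltW// truncnS_gt.
have ma t g : measurable_fun setT (a t g) by case: (ha t).
have cnt (tj : T * C) : ae_prop mu (fun x => forall s : 'I_k,
    #|[pred s' : 'I_k | `[< a tj.1 (e tj.1 s) x = a tj.1 (e tj.1 s') x >]]| <= 1)%N.
  have [N [mN N0 hN]] := free_eq (ha tj.1) (fa tj.1).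
  exists N; split=> // x /hN fx s; rewrite -(card1 s).
  apply/subset_leq_card/fintype.subsetP => s'; rewrite !inE => /asboolP/asboolP h.
  by apply/eqP/val_inj/(he tj.1)/fx; rewrite -h.
have [Y [mY hY]] := @random_map _ _ _ mu S _ (T * C)%type
  (fun j => [set x | P x = j]) k 1 (fun tj s => a tj.1 (e tj.1 s))
  (fun tj s x => tj.2) (fun tj => pr mu [set x | P x = tj.2]) del hS
  (fun j => mP [set j]) isT (fun _ s => ma _ _)
  (fun tj s => @dmeas_cst _ X _ tj.2)
  (fun tj s x => erefl) cnt del0 mk.
exists (P \o Y); split; first exact: dmeas_comp.
move=> t Z j mZ iZ; apply: le_trans hdel.
apply: (equidistributed (F := fun s : 'I_k => e t s) (k := k) (ha t)) => //.
- exact: (dmeas_comp P mY [set j]).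
- by rewrite divr_gt0.
- exact: (hY (t, j)).
Qed.

End Models.

(** * An ergodic action on a standard space *)

Section Continuity.
Context (R : realType) (d : measure_display) (X : measurableType d).
Variable mu : probability X R.

Lemma pr_bigcup_cvg (E : nat -> set X) (eps : R) : (forall n, measurable (E n)) ->
  (forall m n, (m <= n)%N -> E m `<=` E n) -> 0 < eps ->
  exists n, pr mu (\bigcup_n E n) - eps < pr mu (E n).
Proof.
move=> mE ndE e0.
have mU : measurable (\bigcup_n E n) by apply: bigcup_measurable.
have : mu \o E @ \oo --> mu (\bigcup_n E n).
  by apply: nondecreasing_cvg_mu => // m n mn; apply/subsetPset/ndE.
rewrite mu_pr// => /fine_cvgP[_ /cvgrPdist_lt/(_ _ e0)[n _ hn]].
exists n; have := hn n (leqnn n); rewrite /= -/(pr mu (E n)) => h.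
have := le_lt_trans (ler_norm _) h; lra.
Qed.

Lemma pr_bigcap_cvg (E : nat -> set X) (eps : R) : (forall n, measurable (E n)) ->
  (forall m n, (m <= n)%N -> E n `<=` E m) -> 0 < eps ->
  exists n, pr mu (E n) < pr mu (\bigcap_n E n) + eps.
Proof.
move=> mE niE e0.
have [n hn] := @pr_bigcup_cvg (fun n => ~` E n) eps
  (fun n => measurableC (mE n)) (fun m n mn x nEm Em => nEm (niE m n mn x Em)) e0.
exists n; move: hn; rewrite -setC_bigcap !prC//; first lra.
by apply: bigcap_measurable.
Qed.

Lemma pr_ae_eq (A B N : set X) : measurable A -> measurable B -> null mu N ->
  (forall x, ~ N x -> A x <-> B x) -> pr mu A = pr mu B.
Proof.
move=> mA mB [mN N0] AB.
have N0' : pr mu N = 0 by apply/pr_null.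
have h (C D : set X) : measurable C -> measurable D ->
    (forall x, ~ N x -> C x -> D x) -> pr mu C <= pr mu D.
  move=> mC mD CD; rewrite -[leRHS]addr0 -N0'; apply: le_trans (prU_le mu mD mN).
  apply: le_pr => //; first exact: measurableU.
  by move=> x Cx; have [Nx|Nx] := pselect (N x); [right|left; apply: CD].
by apply/eqP; rewrite eq_le !h// => x /AB[].
Qed.

Lemma prU_disjoint (A B : set X) : measurable A -> measurable B ->
  (forall x, A x -> ~ B x) -> pr mu (A `|` B) = pr mu A + pr mu B.
Proof.
move=> mA mB AB; rewrite (prID mu (measurableU _ _ mA mB) mB) addrC.
congr (pr mu _ + pr mu _); apply/seteqP; split=> x /=.
- by case=> -[].
- by move=> Ax; split; [left|exact: AB].
- by case.
- by move=> Bx; split=> //; right.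
Qed.

End Continuity.

(** * Laws of real functions are determined by half-lines *)

Section LawUniqueness.
Context (R : realType) (d : measure_display) (X : measurableType d).
Variable mu : probability X R.

(* The measurability proofs are arguments so that the measure instance below can
   be inferred. *)
Definition restricted_law (A : set X) (mA : measurable A) (u : X -> R)
    (mu_ : measurable_fun setT u) (c : {nonneg R}) (E : set R) : \bar R :=
  (c%:num%:E * mu (u @^-1` E `&` A))%E.

Section Instance.
Variables (A : set X) (mA : measurable A) (u : X -> R).
Variables (mu_ : measurable_fun setT u) (c : {nonneg R}).

Let m := restricted_law mA mu_ c.

Let m0 : m set0 = 0%E.
Proof. by rewrite /m /restricted_law preimage_set0 set0I measure0 mule0. Qed.

Let m_ge0 E : (0 <= m E)%E.
Proof. by rewrite /m /restricted_law mule_ge0. Qed.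

Let m_add : semi_sigma_additive m.
Proof.
move=> F mF tF mUF; pose W n := u @^-1` F n `&` A.
have mW n : measurable (W n).
  by apply: measurableI => //; rewrite -[_ @^-1` _]setTI; apply: mu_.
have tW : trivIset setT W.
  by move=> i j _ _ [x [[Fi _] [Fj _]]]; apply: tF => //; exists (u x).
have UW : \bigcup_n W n = u @^-1` (\bigcup_n F n) `&` A.
  by rewrite preimage_bigcup setI_bigcupl.
have mUW : measurable (\bigcup_n W n) by apply: bigcup_measurable.
have := @measure_semi_sigma_additive _ _ _ mu W mW tW mUW.
rewrite UW /m /restricted_law => hW.
rewrite [X in X @ \oo --> _](_ : _ = (fun n => c%:num%:E *
    \sum_(0 <= i < n) mu (W i)))%E.
  by apply: cvgeZl.
by apply/funext => n; rewrite ge0_sume_distrr.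
Qed.

HB.instance Definition _ := isMeasure.Build _ _ _ (restricted_law mA mu_ c)
  m0 m_ge0 m_add.

End Instance.

(** The half-lines are stable under intersection and generate the Borel sets. The factor [c] allows
    independence to be expressed, by comparing the law on a subset with a multiple of the law on
    [X]. *)
Lemma law_unique (A B : set X) (u v : X -> R) (c : R) : measurable A -> measurable B ->
  measurable_fun setT u -> measurable_fun setT v -> 0 <= c ->
  (forall s, pr mu (u @^-1` `]-oo, s[%classic `&` A) =
     c * pr mu (v @^-1` `]-oo, s[%classic `&` B)) ->
  forall E, measurable E ->
    pr mu (u @^-1` E `&` A) = c * pr mu (v @^-1` E `&` B).
Proof.
move=> mA mB mu_ mv c0 h E mE.
have mpA E' : measurable E' -> measurable (u @^-1` E' `&` A).
  by move=> mE'; apply: measurableI => //; rewrite -[_ @^-1` _]setTI; apply: mu_.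
have mpB E' : measurable E' -> measurable (v @^-1` E' `&` B).
  by move=> mE'; apply: measurableI => //; rewrite -[_ @^-1` _]setTI; apply: mv.
have := @measure_unique _ R _ (@RGenInftyO.G R) (fun k => `]-oo, k%:R[%classic)
  (RGenInftyO.measurableE R) _ _ _ (restricted_law mA mu_ 1%:nng)
  (restricted_law mB mv (NngNum c0)) _ _ E mE.
rewrite /= /restricted_law /= mul1e !mu_pr//; [|exact: mpB|exact: mpA].
rewrite -EFinM => H; apply: EFin_inj; apply: H.
- move=> _ _ [x ->] [y ->]; exists (Num.min x y).
  by apply/seteqP; split=> z /=; rewrite !in_itv /= lt_min; [case=> -> ->|case/andP].
- by move=> k; exists k%:R.
- apply/seteqP; split=> x // _; exists (Num.truncn `|x|).+1 => //=.
  by rewrite in_itv /= (le_lt_trans (ler_norm _))// truncnS_gt.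
- move=> _ [s ->]; rewrite mul1e !mu_pr//; [|exact: mpB|exact: mpA].
  by rewrite -EFinM h.
- move=> k; rewrite mul1e (le_lt_trans (probability_le1 _ _)) ?ltry//.
  exact: mpA.
Qed.

End LawUniqueness.

Section StandardSpace.
Context (R : realType) (d : measure_display) (X : measurableType d).
Variable mu : probability X R.
Hypothesis hX : @standard_borel R d X.

Lemma lt_preimage (u : X -> R) s : u @^-1` `]-oo, s[%classic = [set x | u x < s].
Proof. by apply/seteqP; split=> x /=; rewrite in_itv. Qed.

Lemma le_preimage (u : X -> R) s : u @^-1` `]-oo, s]%classic = [set x | u x <= s].
Proof. by apply/seteqP; split=> x /=; rewrite in_itv. Qed.

Lemma measurable_lt (u : X -> R) s : measurable_fun setT u ->
  measurable [set x | u x < s].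
Proof. by move=> mu_; rewrite -lt_preimage -[_ @^-1` _]setTI; apply: mu_. Qed.

Lemma measurable_le (u : X -> R) s : measurable_fun setT u ->
  measurable [set x | u x <= s].
Proof. by move=> mu_; rewrite -le_preimage -[_ @^-1` _]setTI; apply: mu_. Qed.

Lemma rat_enum : exists e : nat -> rat, forall q, exists n, e n = q.
Proof.
exists (fun n => odflt 0 (unpickle n)) => q.
by exists (pickle q); rewrite pickleK.
Qed.

Lemma exists_separating : exists S : nat -> set X, separating S.
Proof.
have [B [f [mB mf f_inj fB fim]]] := hX; have [e he] := rat_enum.
exists (fun n => [set x | f x < ratr (e n)]); split.
  by move=> n; apply: measurable_lt.
have h x y : f x < f y -> exists n, ~ (f x < ratr (e n) <-> f y < ratr (e n)).
  move=> xy; have [q] := rat_in_itvoo xy; rewrite in_itv /= => /andP[xq qy].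
  have [n en] := he q; exists n; rewrite en => -[/(_ xq)].
  by rewrite ltNge (ltW qy).
move=> x y xy; have [/h//|/h [n hn]|/f_inj//] := ltgtP (f x) (f y).
by exists n => -[? ?]; apply: hn.
Qed.

(* [h] is the distribution function composed with an embedding [f] into the reals,
   and [th] the quantile function composed with the inverse of [f]. *)
Lemma standard_uniform : nonatomic mu ->
  exists (h : X -> R) (th : R -> X), [/\ measurable_fun setT h,
    measurable_fun setT th, forall x, 0 <= h x <= 1,
    forall t, 0 <= t <= 1 -> pr mu [set x | h x < t] = t &
    ae_prop mu (fun x => th (h x) = x)].
Proof.
move=> hna; have [B [f [mB mf f_inj fB fim]]] := hX.
have mle r := measurable_le r mf; have mlt r := measurable_lt r mf.
pose F r := pr mu [set x | f x <= r].
have F_mono r s : r <= s -> F r <= F s.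
  by move=> rs; apply: le_pr => // x /= /le_trans; apply.
have F0 r : 0 <= F r by apply: pr_ge0.
have F1 r : F r <= 1 by rewrite -(prT mu); apply: le_pr.
have lt_of_F r s : F r < F s -> r < s.
  by move=> h; rewrite ltNge; apply/negP => /F_mono; rewrite leNgt h.
have matom r : measurable [set x | f x = r].
  rewrite (_ : [set _ | _] = f @^-1` [set r])//.
  by rewrite -[_ @^-1` _]setTI; apply: mf.
have atom r : pr mu [set x | f x = r] = 0.
  apply: contrapT => /eqP h0.
  have h : 0 < pr mu [set x | f x = r] by rewrite lt_neqAle eq_sym h0 pr_ge0.
  have [|C [mC CA C0 CltA]] := hna _ (matom r); first by rewrite mu_pr// lte_fin.
  have [y Cy] : exists y, C y.
    apply: contrapT => /forallNP nC; move: C0.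
    by rewrite (_ : C = set0) ?measure0 ?ltxx//; apply/seteqP; split=> x //= /nC.
  move: CltA; rewrite (_ : C = [set x | f x = r]) ?ltxx//.
  apply/seteqP; split=> // x /= fx.
  by rewrite (_ : x = y)//; apply: f_inj; rewrite fx (CA _ Cy).
(* Absence of atoms makes [F] left continuous as well, whence [F (G t) = t] below. *)
have Flt r : pr mu [set x | f x < r] = F r.
  rewrite /F (prID mu (mle r) (mlt r)).
  rewrite [X in _ = _ + X](_ : _ = 0) ?addr0.
    by congr (pr mu _); apply/seteqP; split=> x /=; [move=> h; split=> //; exact: ltW|case].
  apply/eqP; rewrite eq_le pr_ge0 andbT -(atom r).
  apply: le_pr => //; first exact: measurableD.
  by move=> x /= [fr /negP]; rewrite -leNgt => rf; apply/eqP; rewrite eq_le fr rf.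
have right r t : F r < t -> exists2 r', r < r' & F r' < t.
  move=> h; have [m n mn x /=||n hn] :=
    @pr_bigcap_cvg _ _ _ mu (fun n => [set x | f x <= r + n.+1%:R^-1]) (t - F r) (fun=> mle _).
  - by move/le_trans; apply; rewrite lerD2l lef_pV2 ?posrE ?ltr0n// ler_nat.
  - by rewrite subr_gt0.
  exists (r + n.+1%:R^-1); first by rewrite ltrDl invr_gt0.
  move: hn; rewrite (_ : \bigcap_n _ = [set x | f x <= r]) -/(F r) -/(F _).
    by move=> H; lra.
  apply/seteqP; split=> x /=; last first.
    by move=> fx k _ /=; rewrite (le_trans fx)// lerDl.
  move=> hx; rewrite leNgt; apply/negP => rf.
  have := hx (Num.truncn ((f x - r)^-1)) I => /=; apply/negP; rewrite -ltNge -ltrBrDl.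
  by rewrite invf_plt ?posrE ?subr_gt0// truncnS_gt.
have left s t : t < F s -> exists2 r, r < s & t < F r.
  rewrite -Flt => h; have [m n mn x /=||n hn] :=
    @pr_bigcup_cvg _ _ _ mu (fun n => [set x | f x <= s - n.+1%:R^-1])
    (pr mu [set x | f x < s] - t) (fun=> mle _).
  - by move/le_trans; apply; rewrite lerD2l lerN2 lef_pV2 ?posrE ?ltr0n// ler_nat.
  - by rewrite subr_gt0.
  exists (s - n.+1%:R^-1); first by rewrite gtrBl invr_gt0.
  move: hn; rewrite (_ : \bigcup_n _ = [set x | f x < s]) -/(F _).
    by move=> H; lra.
  apply/seteqP; split=> x /=.
    by move=> [k _ /= /le_lt_trans]; apply; rewrite gtrBl.
  move=> fs; exists (Num.truncn ((s - f x)^-1)) => //=.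
  by rewrite lerBrDr -lerBrDl ltW// invf_plt ?posrE ?subr_gt0// truncnS_gt.
have low t : 0 < t -> exists r, F r < t.
  move=> t0; have [m n mn x /=|n] :=
    @pr_bigcap_cvg _ _ _ mu (fun n => [set x | f x <= - n%:R]) t (fun=> mle _) _ t0.
    by move/le_trans; apply; rewrite lerN2 ler_nat.
  rewrite (_ : \bigcap_n _ = set0) ?pr0 ?add0r; first by exists (- n%:R).
  apply/seteqP; split=> x //= /(_ (Num.truncn `|f x|).+1 I) /=.
  apply/negP; rewrite -ltNge ltrNl (le_lt_trans _ (truncnS_gt _))//.
  by rewrite -normrN ler_norm.
have up t : t < 1 -> exists r, t < F r.
  move=> t1; have [m n mn x /=||n] :=
    @pr_bigcup_cvg _ _ _ mu (fun n => [set x | f x <= n%:R]) (1 - t) (fun=> mle _).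
  - by move/le_trans; apply; rewrite ler_nat.
  - by rewrite subr_gt0.
  rewrite (_ : \bigcup_n _ = setT) ?prT.
    by move=> H; exists n%:R; rewrite /F; lra.
  apply/seteqP; split=> x // _; exists (Num.truncn `|f x|).+1 => //=.
  by rewrite (le_trans (ler_norm _))// ltW// truncnS_gt.
pose At t := [set r | F r < t]; pose G t := sup (At t).
have hs t : 0 < t < 1 -> has_sup (At t).
  move=> /andP[t0 t1]; split; first by have [r hr] := low t t0; exists r.
  have [u hu] := up t t1; exists u => r /= hr.
  by apply/ltW/lt_of_F; apply: lt_trans hu.
have ubG t r : 0 < t < 1 -> F r < t -> r <= G t.
  by move=> /hs ht hr; apply: ub_le_sup => //; case: ht.
have ltG t r : 0 < t < 1 -> r < G t -> F r < t.
  move=> /hs ht rG; have e0 : 0 < G t - r by rewrite subr_gt0.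
  have [r' hr'] := sup_adherent e0 ht; rewrite opprB addrC subrK => rr'.
  by apply: le_lt_trans hr'; apply/F_mono/ltW.
have FG t : 0 < t < 1 -> F (G t) = t.
  move=> t01; apply/eqP; rewrite eq_le; apply/andP; split; rewrite leNgt; apply/negP.
    by move=> /left [r rG]; apply/negP; rewrite -leNgt ltW// ltG.
  by move=> /right [r Gr] /(ubG _ _ t01); apply/negP; rewrite -ltNge.
pose h x := F (f x).
have mF : measurable_fun setT F.
  by apply: nondecreasing_measurable => // r s; exact: F_mono.
have mh : measurable_fun setT h by apply: measurableT_comp.
have mhlt t := measurable_lt t mh.
have h01 x : 0 <= h x <= 1 by rewrite F0 F1.
have U1 t : 0 < t < 1 -> pr mu [set x | h x < t] = t.
  move=> t01; apply/eqP; rewrite eq_le; apply/andP; split.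
    by rewrite -[leRHS](FG t t01); apply: le_pr => // x /=; apply: ubG.
  by rewrite -[leLHS](FG t t01) -Flt; apply: le_pr => // x /=; apply: ltG.
have U t : 0 <= t <= 1 -> pr mu [set x | h x < t] = t.
  move=> /andP[]; rewrite le_eqVlt => /orP[/eqP <- _|t0].
    rewrite (_ : [set _ | _] = set0) ?pr0//; apply/seteqP; split=> x //=.
    by rewrite ltNge F0.
  rewrite le_eqVlt => /orP[/eqP ->|t1]; last by apply: U1; rewrite t0.
  apply/eqP; rewrite eq_le; apply/andP; split.
    by rewrite -(prT mu); apply: le_pr.
  rewrite leNgt; apply/negP => lt1; set p := pr mu _ in lt1.
  have p0 : 0 <= p by apply: pr_ge0.
  have q01 : 0 < (1 + p) / 2 < 1 by apply/andP; split; lra.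
  have := U1 _ q01; have : pr mu [set x | h x < (1 + p) / 2] <= p.
    by apply: le_pr => // x /= /lt_trans; apply; lra.
  by lra.
have mheq c : measurable [set x | h x = c].
  rewrite (_ : [set _ | _] = h @^-1` [set c])//.
  by rewrite -[_ @^-1` _]setTI; apply: mh.
have nheq c : null mu [set x | h x = c].
  split=> //; apply/pr_null => //; apply/eqP; rewrite eq_le pr_ge0 andbT.
  have [c0|c0] := ltP c 0.
    rewrite (_ : [set _ | _] = set0) ?pr0//; apply/seteqP; split=> x //= hc.
    by move: (h01 x); rewrite hc; lra.
  have [c1|c1] := ltP c 1; last first.
    have <- : pr mu (~` [set x | h x < 1]) = 0.
      by rewrite prC// U ?subrr// ler01 lexx.
    apply: le_pr => //; first exact: measurableC.
    by move=> x /= ->; apply/negP; rewrite -leNgt.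
  rewrite leNgt; apply/negP; set p := pr mu _ => p0.
  (* With this [e] the values in [[c, c + e[] have probability [e < p], too little to contain an
     atom of mass [p] at [c]. *)
  pose e := Num.min p (1 - c) / 2.
  have [e0 ep ec] : [/\ 0 < e, e < p & c + e < 1].
    by rewrite /e /Num.min; case: ifP => h'; split; lra.
  have : p + pr mu [set x | h x < c] <= pr mu [set x | h x < c + e].
    rewrite (prID mu (mhlt (c + e)) (mheq c)); apply: lerD.
      by apply: le_pr => //; [exact: measurableI|move=> x /= ->; split=> //; lra].
    apply: le_pr => //; first exact: measurableD.
    by move=> x /= hc; split; [lra|move=> e'; move: hc; rewrite e' ltxx].
  by rewrite !U; lra.
have [x0 _] := prob_inhabited mu.
pose D : set R := [set t | 0 < t < 1].
have mD : measurable D.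
  by rewrite (_ : D = `]0, 1[%classic)//; apply/seteqP; split=> t /=; rewrite in_itv.
have mG : measurable_fun D G.
  have G_mono s t : D s -> D t -> s <= t -> G s <= G t.
    move=> s01 t01 st; apply: sup_le; last exact: hs.
      move=> r /= hr; exists r; split=> //=; exact: lt_le_trans st.
    by case: (hs s s01).
  apply: (measurability (@RGenCInfty.G R)) => [|/= _ [_] [r] -> <-].
    exact: RGenCInfty.measurableE.
  apply: is_interval_measurable => s t /= [Ds] + [Dt] + u /andP[su ut].
  rewrite !in_itv /= !andbT => Gs Gt.
  have Du : D u.
    move: Ds Dt; rewrite /D /= => /andP[s0 _] /andP[_ t1].
    by rewrite (lt_le_trans s0 su) (le_lt_trans ut t1).
  by split=> //; rewrite (le_trans Gs)// G_mono.
(* The default [x0] covers parameters outside []0, 1[] and quantiles that [f] does not attain. *)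
have /choice[th hth] : forall t, exists y,
    ((D t /\ exists z, f z = G t) /\ f y = G t) \/
    (~ (D t /\ exists z, f z = G t) /\ y = x0).
  move=> t; have [[Dt [z hz]]|n] := pselect (D t /\ exists z, f z = G t).
    by exists z; left; split=> //; split=> //; exists z.
  by exists x0; right.
have mth : measurable_fun setT th.
  move=> _ C mC; rewrite setTI.
  have mDG E : measurable E -> measurable (D `&` G @^-1` E) by move=> mE; apply: mG.
  pose Dg := D `&` G @^-1` (f @` setT).
  have mDg : measurable Dg by apply: mDG; apply: fim.
  rewrite (_ : _ @^-1` C = (D `&` G @^-1` (f @` C)) `|` (~` Dg `&` [set _ | C x0])).
    apply: measurableU; first by apply: mDG; apply: fim.
    by apply: measurableI; [exact: measurableC|exact: measurable_prop].
  apply/seteqP; split=> t /=.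
    case: (hth t) => [[[Dt _] ft]|[nt ->]] Ct.
      by left; split=> //; exists (th t).
    by right; split=> // -[Dt [z _ hz]]; apply: nt; split=> //; exists z.
  case: (hth t) => [[[Dt [z hz]] ft]|[nt ->]].
    case=> [[_ [y Cy fy]]|[nD _]].
      by rewrite (_ : th t = y)//; apply: f_inj; rewrite ft fy.
    by exfalso; apply: nD; split=> //; exists z.
  by case=> [[Dt [y Cy fy]]|[]//]; exfalso; apply: nt; split=> //; exists y.
exists h, th; split=> //.
have [e he] := rat_enum.
(* If the quantile of [h x] lies strictly below [f x], then [F] is constant between them and [h x]
   is the value of [F] at a rational; there are countably many such levels, each null. *)
pose N := [set x | h x = 0] `|` [set x | h x = 1] `|`
  \bigcup_q [set x | h x = F (ratr q)].
have [mN N0] : null mu N.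
  apply: null_setU; first exact: null_setU.
  by apply: (null_bigcupT he) => q.
exists N; split=> // x Nx.
have Dx : D (h x).
  have := h01 x; rewrite !le_eqVlt => /andP[/orP[/eqP h0|h0] /orP[/eqP h1|h1]].
  - by exfalso; apply: Nx; left; left.
  - by exfalso; apply: Nx; left; left.
  - by exfalso; apply: Nx; left; right.
  - by rewrite /D /= h0.
have Gf : G (h x) = f x.
  apply/eqP; rewrite eq_le; apply/andP; split.
    apply: ge_sup; first by case: (hs _ Dx).
    by move=> r /= /lt_of_F /ltW.
  rewrite leNgt; apply/negP => Gx.
  have [q] := rat_in_itvoo Gx; rewrite in_itv /= => /andP[Gq qx].
  have : F (ratr q) <= h x by apply/F_mono/ltW.
  rewrite le_eqVlt => /orP[/eqP Fq|/(ubG _ _ Dx)]; last by rewrite leNgt Gq.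
  by apply: Nx; right; exists q.
case: (hth (h x)) => [[_ fx]|[n _]]; first by apply: f_inj; rewrite fx.
by exfalso; apply: n; split=> //; exists x.
Qed.

End StandardSpace.

(** * Rotations of the circle by rational numbers *)

Definition rat_group : group :=
  {| gcar := rat; gmul := +%R; ginv := -%R; gone := 0;
     gmulA := @addrA rat; gmul1 := @add0r rat; gmulV := @addNr rat |}.

Section Rotation.
Variable R : realType.

Definition frac (y : R) : R := y - (Num.floor y)%:~R.

Definition rot (q : rat) (t : R) : R := frac (t + ratr q).

Lemma frac_ge0 y : 0 <= frac y.
Proof. by rewrite subr_ge0; have /andP[] := floor_itv y. Qed.

Lemma frac_lt1 y : frac y < 1.
Proof. by have /andP[_] := floor_itv y; rewrite /frac intrD; lra. Qed.

Lemma frac_id y : 0 <= y < 1 -> frac y = y.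
Proof.
by move=> y01; rewrite /frac (@floor_def _ y 0) ?subr0// add0r.
Qed.

Lemma fracDz y (z : int) : frac (y + z%:~R) = frac y.
Proof.
by rewrite /frac floorDrz ?intr_int// intrKfloor intrD; ring.
Qed.

Lemma frac_fracD y z : frac (frac y + z) = frac (y + z).
Proof.
by rewrite {2}/frac -addrA (addrC (- _)) addrA -rmorphN fracDz.
Qed.

Lemma rotD q r t : rot q (rot r t) = rot (q + r) t.
Proof. by rewrite /rot frac_fracD rmorphD /= -addrA (addrC (ratr q)). Qed.

Lemma rot0 t : 0 <= t < 1 -> rot 0 t = t.
Proof. by move=> t01; rewrite /rot rmorph0 addr0 frac_id. Qed.

Lemma frac_add (s t : R) : 0 <= s < 1 -> 0 <= t < 1 ->
  frac (t + s) = if t < 1 - s then t + s else t + s - 1.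
Proof.
move=> /andP[s0 s1] /andP[t0 t1]; case: ifPn; rewrite -?leNgt => ts.
  by rewrite frac_id//; apply/andP; split; lra.
have -> : t + s = (t + s - 1) + (1 : int)%:~R by rewrite mulr1z subrK.
by rewrite fracDz frac_id ?addrK//; apply/andP; split; lra.
Qed.

Lemma measurable_rot q : measurable_fun setT (rot q).
Proof.
have h : measurable_fun setT (fun t : R => t + ratr q) by apply: measurable_funD.
rewrite /rot /frac; apply: measurable_funB => //.
apply: (measurableT_comp (f := fun y : R => (Num.floor y)%:~R : R)) => //.
apply: nondecreasing_measurable => // x y xy.
by rewrite ler_int le_floor.
Qed.

End Rotation.

Section Ergodic.
Context (R : realType) (d : measure_display) (X : measurableType d).
Variable mu : probability X R.
Hypothesis hX : @standard_borel R d X.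
Hypothesis hna : nonatomic mu.

(** Up to the null event [h = 1], the values rotated into [[0, s[] form one interval, or two
    disjoint ones when [s] is at least the rotation number [q0], of total length [s]; half-lines
    suffice by [law_unique]. *)
Lemma rotation_law (h : X -> R) (q : rat) : measurable_fun setT h ->
  (forall x, 0 <= h x <= 1) ->
  (forall t, 0 <= t <= 1 -> pr mu [set x | h x < t] = t) ->
  forall E, measurable E ->
    pr mu ((rot q \o h) @^-1` E) = pr mu (h @^-1` E).
Proof.
move=> mh h01 U E mE.
have mr : measurable_fun setT (rot q \o h).
  by apply: measurableT_comp => //; apply: measurable_rot.
have -> : (rot q \o h) @^-1` E = (rot q \o h) @^-1` E `&` setT by rewrite setIT.
have -> : h @^-1` E = h @^-1` E `&` setT by rewrite setIT.
rewrite -[RHS]mul1r; apply: law_unique => // s.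
rewrite !setIT mul1r !lt_preimage.
pose N := ~` [set x | h x < 1].
have mlt t := measurable_lt t mh.
have nN : null mu N.
  split; first exact: measurableC.
  apply/pr_null; first exact: measurableC.
  by rewrite prC// U ?subrr// ler01 lexx.
pose q0 : R := frac (ratr q).
have /andP[q00 q01] : 0 <= q0 < 1 by rewrite frac_ge0 frac_lt1.
have rotE x : ~ N x -> rot q (h x) = if h x < 1 - q0 then h x + q0 else h x + q0 - 1.
  move=> /contrapT /= hx1; rewrite -frac_add ?q00// ?hx1 ?andbT; last by case/andP: (h01 x).
  have := frac_fracD (ratr q) (h x).
  by rewrite -/q0 (addrC q0) (addrC (ratr q)) => ->.
have [s0|s0] := ltP 0 s; last first.
  congr (pr mu _); apply/seteqP; split=> x /= /lt_le_trans /(_ s0).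
    by rewrite ltNge frac_ge0.
  by have /andP[+ _] := h01 x; rewrite leNgt => /negP.
have [s1|s1] := ltP s 1; last first.
  apply: (pr_ae_eq (measurable_lt s mr) (mlt s) nN) => x /contrapT /= hx1.
  split=> _; first exact: lt_le_trans s1.
  by apply: lt_le_trans s1; apply: frac_lt1.
rewrite (U s); last by rewrite !ltW.
have [sq|sq] := leP q0 s.
  rewrite (pr_ae_eq (B := [set x | h x < s - q0] `|` ~` [set x | h x < 1 - q0]) _ _ nN).
  - rewrite prU_disjoint//; [|exact: measurableC|by move=> x /= hx; apply; lra].
    rewrite prC// !U; first by ring.
    + by apply/andP; split; lra.
    + by apply/andP; split; lra.
  - exact: measurable_lt.
  - by apply: measurableU => //; apply: measurableC.
  move=> x Nx /=; rewrite rotE//; move: Nx => /contrapT /= hx1.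
  have := h01 x; case: ifPn; rewrite -?leNgt => hq hx.
    by split; [left; lra|case=> [?|nh]; [lra|case: nh]].
  by split; [move=> _; right|lra].
rewrite (pr_ae_eq (B := [set x | h x < 1 + s - q0] `\` [set x | h x < 1 - q0]) _ _ nN).
- have := prID mu (mlt (1 + s - q0)) (mlt (1 - q0)).
  rewrite (setIidr _); last by move=> x /=; lra.
  by rewrite !U; lra.
- exact: measurable_lt.
- exact: measurableD.
move=> x Nx /=; rewrite rotE//; move: Nx => /contrapT /= hx1.
have := h01 x; case: ifPn; rewrite -?leNgt => hq hx.
  by split; [lra|case=> _].
by split; [move=> ?; split; [lra|]|lra].
Qed.

(* The rationals act by rotation of the circle, transported to [X]. *)
Lemma ergodic_action : exists (e : nat -> rat_group) (a : rat_group -> X -> X),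
  [/\ forall g, exists n, e n = g, act mu a &
    forall Z, measurable Z -> invariant a Z -> pr mu Z = 0 \/ pr mu Z = 1].
Proof.
have [h [th [mh mth h01 U [N0 [mN0 N00 hN0]]]]] := standard_uniform hX hna.
have [S hS] := exists_separating hX.
have [e he] := rat_enum.
have mlt t := measurable_lt t mh.
have mpR E : measurable E -> measurable (h @^-1` E).
  by move=> mE; rewrite -[_ @^-1` _]setTI; apply: mh.
have mpX E : measurable E -> measurable (th @^-1` E).
  by move=> mE; rewrite -[_ @^-1` _]setTI; apply: mth.
have mrot q : measurable_fun setT (rot q \o h).
  by apply: measurableT_comp => //; apply: measurable_rot.
have mprot q E : measurable E -> measurable ((rot q \o h) @^-1` E).
  by move=> mE; rewrite -[_ @^-1` _]setTI; apply: mrot.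
have law q E : measurable E -> pr mu ((rot q \o h) @^-1` E) = pr mu (h @^-1` E).
  by apply: rotation_law.
pose B := [set t : R | h (th t) <> t].
have mB : measurable B.
  rewrite (_ : B = ~` ((fun t : R => h (th t) - t) @^-1` [set 0])).
    apply: measurableC; rewrite -[_ @^-1` _]setTI.
    by apply: measurable_funB => //; apply: measurableT_comp.
  apply/seteqP; split=> t /=; rewrite /B /=.
    by move=> ht /eqP; rewrite subr_eq0 => /eqP.
  by move=> ht e'; apply: ht; rewrite e' subrr.
(* The points along whose rotation orbit [h] and [th] are not inverse to each other, or where [h]
   attains [1]. The complement is preserved by all rotations, so the transported action is exact
   there and trivial on [N]. *)
pose N := [set x | th (h x) <> x] `|` ~` [set x | h x < 1] `|`
  \bigcup_q ((rot q \o h) @^-1` B).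
have mthh : measurable [set x | th (h x) <> x].
  apply: (@measurableC _ _ [set x | th (h x) = x]).
  by apply: (measurable_eq_fun hS) => //; apply: measurableT_comp.
have [mN nN] : null mu N.
  apply: null_setU; first apply: null_setU.
  - by apply: null_sub (conj mN0 N00) => // x /= hx; apply: contrapT => /hN0.
  - split; first exact: measurableC.
    apply/pr_null; first exact: measurableC.
    by rewrite prC// U ?subrr// ler01 lexx.
  apply: (null_bigcupT he) => q; split; first exact: mprot.
  apply/pr_null; first exact: mprot.
  rewrite law//; apply/pr_null; first exact: mpR.
  case: (@null_sub _ _ _ mu (h @^-1` B) N0 (mpR _ mB)) => // x /= hx.
  by apply: contrapT => /hN0 e'; apply: hx; rewrite e'.
have good x : ~ N x -> [/\ th (h x) = x, 0 <= h x < 1 &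
    forall q, h (th (rot q (h x))) = rot q (h x)].
  move=> Nx; split.
  - by apply: contrapT => hx; apply: Nx; left; left.
  - have /andP[-> _] := h01 x; apply: contrapT => hx.
    by apply: Nx; left; right.
  - by move=> q; apply: contrapT => hx; apply: Nx; right; exists q.
have inv q x : ~ N x -> ~ N (th (rot q (h x))).
  move=> /good [e1 hx gx] [[]|[r _]].
  - by rewrite /= gx.
  - by apply; rewrite /= gx; apply: frac_lt1.
  by rewrite /B /= gx rotD gx.
pose a (q : rat_group) x := if `[< N x >] then x else th (rot q (h x)).
have aN q x : N x -> a q x = x by rewrite /a; case: asboolP.
have aE q x : ~ N x -> a q x = th (rot q (h x)) by rewrite /a; case: asboolP.
have ma q : measurable_fun setT (a q).
  rewrite /a => _ C mC; rewrite setTI.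
  rewrite (_ : _ @^-1` C = (C `&` N) `|` ((rot q \o h) @^-1` (th @^-1` C) `&` ~` N)).
    apply: measurableU; apply: measurableI => //; last exact: measurableC.
    by apply: mprot; apply: mpX.
  apply/seteqP; split=> x /=; have [Nx|Nx] := pselect (N x).
  - by rewrite -/(a q x) aN//; left.
  - by rewrite -/(a q x) aE//; right.
  - by rewrite -/(a q x) aN// => -[[]|[]].
  - by rewrite -/(a q x) aE// => -[[]|[]].
have hact : act mu a.
  split=> //.
  - move=> q C mC; rewrite !mu_pr//; last exact: measurable_preim.
    congr (_%:E); transitivity (pr mu ((rot q \o h) @^-1` (th @^-1` C))).
      apply: (pr_ae_eq _ _ (conj mN nN)); [exact: measurable_preim|by apply: mprot; apply: mpX|].
      by move=> x Nx; rewrite /= aE.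
    rewrite law; last exact: mpX.
    apply: (pr_ae_eq _ _ (conj mN nN)) => //; first by apply: mpR; apply: mpX.
    by move=> x /good [hx _ _]; rewrite /= hx.
  - move=> x; have [Nx|Nx] := pselect (N x); first exact: aN.
    by rewrite aE//=; have [hx h1 _] := good x Nx; rewrite rot0.
  - move=> q r x; have [Nx|Nx] := pselect (N x); first by rewrite !aN.
    rewrite (aE r x Nx) !aE//; last exact: inv.
    by have [_ _ gx] := good x Nx; rewrite gx rotD.
exists e, a; split=> // Z mZ iZ.
(* The rotation by [i / n] moves the first interval of length [1 / n] to the one starting at
   [i / n], and [Z] is invariant, so all these intervals carry the same part of [Z]. Monotonicity
   then makes [D] linear, that is, [Z] is independent of [h]. *)
pose D s := pr mu ([set x | h x < s] `&` Z).
have mD s : measurable ([set x | h x < s] `&` Z) by apply: measurableI.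
have D_mono s t : s <= t -> D s <= D t.
  by move=> st; apply: le_pr => // x /= [hx ?]; split=> //; apply: lt_le_trans st.
have D0 : D 0 = 0.
  rewrite /D (_ : _ `&` _ = set0) ?pr0//; apply/seteqP; split=> x //= [].
  by have /andP[+ _] := h01 x; rewrite leNgt => /negP.
have D1 : D 1 = pr mu Z.
  apply: (pr_ae_eq (mD 1) mZ (conj mN nN)) => x /good [_ /andP[_ hx] _].
  by rewrite /=; split=> [[]|].
have Dstep n i : (i.+1 <= n)%N ->
    D (i.+1%:R / n%:R) = D (i%:R / n%:R) + D (1 / n%:R).
  move=> lt_in; have n0 : 0 < n%:R :> R by rewrite ltr0n (leq_trans _ lt_in).
  pose q : rat := i%:R / n%:R.
  have qE : ratr q = i%:R / n%:R :> R by rewrite fmorph_div !rmorph_nat.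
  have le1 : i.+1%:R / n%:R <= 1 :> R by rewrite ler_pdivrMr// mul1r ler_nat.
  have eS : i.+1%:R / n%:R = i%:R / n%:R + 1 / n%:R :> R by rewrite -natr1 mulrDl.
  have in0 : 0 <= i%:R / n%:R :> R by rewrite divr_ge0// ltW.
  have n1 : 0 < 1 / n%:R :> R by rewrite divr_gt0.
  rewrite eS {1}/D (prID mu (mD _) (mlt (i%:R / n%:R))); congr (_ + _).
    congr (pr mu _); apply/seteqP; split=> x /=; first by case=> -[].
    by case=> hx Zx; split=> //; split=> //; lra.
  set W := _ `\` _; have mW : measurable W by apply: measurableD.
  case: (hact) => _ /(_ q W mW) muW _ _.
  rewrite /pr -muW -/(pr mu _) /D -/(pr mu _).
  apply: (pr_ae_eq _ _ (conj mN nN)) => //; first by apply: measurable_preim.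
  move=> x Nx; have [_ hx gx] := good x Nx.
  rewrite /W /= -[Z (a q x)]/((fun y => Z y) (a q x)).
  have -> : Z (a q x) = Z x by apply/propext; exact: (@invariantE _ _ _ mu rat_group a hact Z q x iZ).
  rewrite aE// gx /rot qE frac_add//; last by apply/andP; split; lra.
  rewrite eS in le1; have /andP[hx0 hx1] := hx.
  set y := if _ then _ else _.
  have key : (y < i%:R / n%:R + 1 / n%:R /\ ~ (y < i%:R / n%:R)) <-> h x < 1 / n%:R.
    rewrite /y; case: ifPn; rewrite -?leNgt => hc; split.
    - by case=> h1 _; lra.
    - by move=> h1; split; [lra|apply/negP; rewrite -leNgt; lra].
    - by case=> h1 /negP; rewrite -leNgt; lra.
    - move=> h1; have lt00 : (0 : R) < 0 by lra.
      by move: lt00; rewrite ltxx.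
  by move: key; tauto.
have Dn n i : (i <= n)%N -> D (i%:R / n%:R) = i%:R * D (1 / n%:R).
  elim: i => [|i ih] hi; first by rewrite !mul0r.
  by rewrite Dstep// ih ?(ltnW hi)// -natr1; ring.
have Dnn n i : (0 < n)%N -> (i <= n)%N -> D (i%:R / n%:R) = i%:R / n%:R * pr mu Z.
  move=> n0 hi; rewrite Dn//; have := Dn n n (leqnn n).
  have nR : n%:R != 0 :> R by rewrite pnatr_eq0 -lt0n.
  by rewrite divff// D1 => ->; field.
have Z1 : pr mu Z <= 1 by rewrite -(prT mu); apply: le_pr.
have Z0 := pr_ge0 mu Z.
have Ds s : 0 <= s < 1 -> D s = s * pr mu Z.
  move=> /andP[s0 s1]; apply: contrapT => /eqP; rewrite -subr_eq0 -normr_gt0 => d0.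
  pose n := (Num.truncn (`|D s - s * pr mu Z|^-1)).+1.
  have n0 : 0 < n%:R :> R by rewrite ltr0n.
  have hn : 1 / n%:R < `|D s - s * pr mu Z|.
    by rewrite div1r invf_plt ?posrE// truncnS_gt.
  have sn0 : 0 <= s * n%:R by rewrite mulr_ge0// ltW.
  have /andP[l1 l2] := truncn_itv sn0; set i := Num.truncn _ in l1 l2.
  have iltn : (i < n)%N.
    by rewrite -(ltr_nat R) (le_lt_trans l1)// gtr_pMl.
  have h1 : i%:R / n%:R <= s by rewrite ler_pdivrMr.
  have h2 : s <= i.+1%:R / n%:R by rewrite ler_pdivlMr// ltW.
  have := D_mono _ _ h1; have := D_mono _ _ h2.
  rewrite !Dnn// ?(ltnW iltn)//.
  have eS : i.+1%:R / n%:R = i%:R / n%:R + 1 / n%:R :> R by rewrite -natr1 mulrDl.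
  move: hn h1 h2; rewrite eS.
  set u := i%:R / n%:R; set v := 1 / n%:R; set z := pr mu Z.
  have v0 : 0 < v by rewrite divr_gt0.
  move=> hn h1 h2 k1 k2; move: hn; apply/negP; rewrite -leNgt ler_norml.
  have p1 : 0 <= (s - u) * z by rewrite mulr_ge0// subr_ge0.
  have p2 : 0 <= (u + v - s) * z by rewrite mulr_ge0// subr_ge0.
  have p3 : v * z <= v by rewrite ler_piMr// ltW.
  by apply/andP; split; lra.
have law2 E : measurable E -> pr mu (h @^-1` E `&` Z) = pr mu Z * pr mu (h @^-1` E).
  move=> mE; rewrite -[X in _ * pr mu X]setIT; apply: law_unique => // s.
  rewrite lt_preimage setIT -/(D s).
  have [s0|s0] := ltP s 0.
    have -> : [set x | h x < s] = set0.
      by apply/seteqP; split=> x //= hx; have := h01 x; lra.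
    rewrite pr0 mulr0; apply/eqP; rewrite eq_le pr_ge0 andbT -D0.
    by apply: D_mono; apply: ltW.
  have [s1|s1] := ltP s 1; first by rewrite Ds ?s0// U 1?mulrC// s0 ltW.
  have -> : pr mu [set x | h x < s] = 1.
    apply/eqP; rewrite eq_le -{1}(prT mu) le_pr//= -[leLHS](U 1) ?ler01 ?lexx//.
    by apply: le_pr => // x /= /lt_le_trans; apply.
  rewrite mulr1; apply/eqP; rewrite eq_le -{2}D1 D_mono// andbT.
  by apply: le_pr => // x [].
(* Almost everywhere [Z] is itself determined by [h], so it is independent of itself and its measure
   equals its own square. *)
have := law2 _ (mpX _ mZ).
have e1 : pr mu (h @^-1` (th @^-1` Z)) = pr mu Z.
  apply: (pr_ae_eq _ _ (conj mN nN)) => //; first by apply: mpR; apply: mpX.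
  by move=> x /good [hx _ _]; rewrite /= hx.
have e2 : pr mu (h @^-1` (th @^-1` Z) `&` Z) = pr mu Z.
  apply: (pr_ae_eq _ _ (conj mN nN)) => //.
    by apply: measurableI => //; apply: mpR; apply: mpX.
  by move=> x /good [hx _ _]; rewrite /= hx; split=> [[]|].
rewrite e1 e2 => zz; have : pr mu Z * (pr mu Z - 1) = 0 by rewrite mulrBr -zz mulr1 subrr.
by move/eqP; rewrite mulf_eq0 subr_eq0 => /orP[/eqP ->|/eqP ->]; [left|right].
Qed.

End Ergodic.

(** * Free products *)

Section FreeProduct.
Variables (I : Type) (A : I -> group) (G : group) (iota : forall i, A i -> G).
Arguments iota {i}.
Hypothesis hG : @free_product I A G (@iota).

Let iota_hom i : is_hom (@iota i) := hG.1 i.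

(** Words in the factors; later statements about [G] are proved by induction on them. *)
Inductive generated : G -> Prop :=
| generated1 : generated (gone G)
| generatedM i (a : A i) g : generated g -> generated (gmul (iota a) g).

Lemma generated_mul g h : generated g -> generated h -> generated (gmul g h).
Proof.
elim=> [|i a {}g _ ih] gh; first by rewrite gmul1.
by rewrite -gmulA; apply: generatedM; apply: ih.
Qed.

Lemma generated_iota i (a : A i) : generated (iota a).
Proof. by rewrite -(gmulr1 (iota a)); apply/generatedM/generated1. Qed.

Lemma generated_inv g : generated g -> generated (ginv g).
Proof.
elim=> [|i a {}g _ ih].
  by rewrite (_ : ginv _ = gone G) ?gmulr1; [exact: generated1|rewrite -[LHS]gmulr1 gmulV].
rewrite ginvM; apply: generated_mul => //.
by rewrite -(homV (@iota_hom i)); apply: generated_iota.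
Qed.

Lemma sub_eq (T : Type) (P : T -> Prop) (x y : {t | P t}) : sval x = sval y -> x = y.
Proof.
case: x y => [x px] [y py] /= xy; subst y.
by rewrite (Prop_irrelevance px py).
Qed.

Definition generated_group : group.
Proof.
refine (@Defs.Group {g | generated g}
  (fun x y => exist generated (gmul (sval x) (sval y)) (generated_mul (svalP x) (svalP y)))
  (fun x => exist generated (ginv (sval x)) (generated_inv (svalP x)))
  (exist generated (gone G) generated1) _ _ _).
- by move=> x y z; apply: sub_eq; rewrite /= gmulA.
- by move=> x; apply: sub_eq; rewrite /= gmul1.
- by move=> x; apply: sub_eq; rewrite /= gmulV.
Defined.

(** The universal property maps [G] into the generated subgroup. Composed with the inclusion this
    map agrees with the identity on the factors, hence everywhere by uniqueness. *)
Lemma free_product_generated g : generated g.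
Proof.
have [_ univ] := hG.
have [|psi [psi_hom psi_iota _]] := univ generated_group
  (fun i a => exist generated (iota a) (generated_iota a)).
  by move=> i a b; apply: sub_eq; rewrite /= iota_hom.
have [pid [_ _ uniq]] := univ G (@iota) iota_hom.
have e1 : sval (psi g) = pid g.
  apply: (uniq (fun g => sval (psi g))) => [x y|i a]; first by rewrite psi_hom.
  by rewrite psi_iota.
have e2 : g = pid g by apply: (uniq id).
by rewrite e2 -e1; apply: svalP.
Qed.

(** The identity of [A i] and the trivial maps on the other factors extend to a retraction of [G]
    onto [A i]. *)
Lemma iota_inj i : injective (@iota i).
Proof.
have [_ univ] := hG.
pose phi j (x : A j) : A i := match pselect (j = i) with
  | left e => eq_rect j (fun k => gcar (A k)) x i e
  | right _ => gone (A i) end.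
have [|psi [_ psi_iota _]] := univ (A i) phi.
  move=> j x y; rewrite /phi; case: pselect => [e|_]; last by rewrite gmul1.
  by subst i.
have K a : psi (iota a) = a.
  rewrite psi_iota /phi; case: pselect => // e.
  by rewrite (Prop_irrelevance e erefl).
by move=> a b ab; rewrite -(K a) ab K.
Qed.

Hypothesis hI : at_most_countable I.
Hypothesis hA : forall i, countably_infinite (A i).

Lemma free_product_countable : exists e : nat -> G, forall g, exists n, e n = g.
Proof.
have [f f_inj] := hI.
pose en i := projT1 (cid (countably_infinite_enum (hA i))).
have en_surj i (a : A i) : exists n, en i n = a.
  by rewrite /en; case: cid => en' [? h]; apply: h.
have /choice[dec hdec] : forall p : nat * nat, exists o : option {i & A i},
    forall i, f i = p.1 -> o = Some (existT _ i (en i p.2)).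
  move=> p; have [[i hi]|n] := pselect (exists i, f i = p.1).
    exists (Some (existT _ i (en i p.2))) => j hj.
    by have -> : i = j by apply: f_inj; rewrite hi hj.
  by exists None => i hi; exfalso; apply: n; exists i.
pose ev (w : seq (nat * nat)) := foldr (fun p g =>
  if dec p is Some s then gmul (iota (projT2 s)) g else g) (gone G) w.
exists (fun n => ev (odflt [::] (unpickle n))) => g.
suff [w <-] : exists w, ev w = g by exists (pickle w); rewrite pickleK.
elim: (free_product_generated g) => [|i a {}g _ [w <-]]; first by exists [::].
have [n en_a] := en_surj i a; exists ((f i, n) :: w).
by rewrite /ev /= (hdec (f i, n) i erefl) /= en_a.
Qed.

End FreeProduct.

(** * Automorphisms as a target for the universal property *)

Section Automorphisms.
Context (R : realType) (d : measure_display) (X : measurableType d).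
Variable mu : probability X R.

(** These are maps rather than classes modulo null sets, with the inverse as data: the group laws
    are equations, and a homomorphism from the free product gives an exact action. *)
Record autom := Autom { aut_fun : X -> X; aut_inv : X -> X;
  autP : mp_aut_pair mu aut_fun aut_inv }.

Lemma autom_eq (S T : autom) : aut_fun S = aut_fun T -> aut_inv S = aut_inv T -> S = T.
Proof.
case: S T => [s s' hs] [t t' ht] /= e e'; subst t t'.
by rewrite (Prop_irrelevance hs ht).
Qed.

Definition autom_group : group.
Proof.
refine (@Defs.Group autom
  (fun S T => Autom (mp_aut_pair_comp (autP S) (autP T)))
  (fun S => Autom (mp_aut_pair_sym (autP S)))
  (Autom (mp_aut_pair_id mu)) _ _ _).
- by move=> S T U; apply: autom_eq.
- by move=> S; apply: autom_eq.
- move=> S; have [_ _ ST TS _] := autP S.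
  by apply: autom_eq; apply/funext => x /=; rewrite ST.
Defined.

Lemma act_of_hom (G : group) (psi : G -> autom_group) : is_hom psi ->
  act mu (fun g => aut_fun (psi g)).
Proof.
move=> hpsi; split.
- by move=> g; case: (autP (psi g)).
- by move=> g B mB; case: (autP (psi g)) => _ _ _ _; apply.
- by move=> x; rewrite hom1.
- by move=> g h x; rewrite hpsi.
Qed.

Lemma conj_pair (T S U V : X -> X) : mp_aut_pair mu T S -> mp_aut_pair mu U V ->
  mp_aut_pair mu (T \o U \o S) (T \o V \o S).
Proof.
move=> hT hU.
have := mp_aut_pair_comp (mp_aut_pair_comp hT hU) (mp_aut_pair_sym hT).
by rewrite -[X in mp_aut_pair mu _ X]/(T \o (V \o S)).
Qed.

End Automorphisms.

(** * Density *)

Section Density.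
Context (R : realType) (d : measure_display) (X : measurableType d).
Variable mu : probability X R.
Variables (I : Type) (A : I -> group) (G : group) (iota : forall i, A i -> G).
Arguments iota {i}.
Hypothesis hA : forall i, abelian_group (A i) /\ countably_infinite (A i).
Hypothesis hG : @free_product I A G (@iota).

Let iota_hom i : is_hom (@iota i) := hG.1 i.

Definition close (b c : G -> X -> X) (g : G) (B : set X) (eps : R) :=
  small mu eps (fun x => B (c g x) <-> B (b g x)).

Lemma act_comp_iota (a : G -> X -> X) i : act mu a ->
  act mu (fun g : A i => a (iota g)).
Proof.
move=> [ma mua a1 aM].
split=> [g|g|x|g h x]; [exact: ma|exact: mua|by rewrite hom1|by rewrite iota_hom aM].
Qed.

Lemma ess_free_comp_iota (a : G -> X -> X) i : ess_free mu a ->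
  ess_free mu (fun g : A i => a (iota g)).
Proof.
move=> [N [mN N0 hN]]; exists N; split=> // x Nx g g1; apply: hN => // ig.
by apply: g1; apply: (iota_inj hG); rewrite ig hom1.
Qed.

(** Induction on a word: a product of [iota a] and [g] is controlled at [B] if [iota a] is
    controlled at [B] and [g] at the preimage of [B] under [b (iota a)], with half of the error for
    each. *)
Lemma close_reduction (b : G -> X -> X) (g : G) (B : set X) (eps : R) :
  act mu b -> measurable B -> 0 < eps ->
  exists (L : seq ({i & A i} * set X)) (del : R), [/\ 0 < del,
    forall c, List.In c L -> measurable c.2 &
    forall be, act mu be ->
      (forall c, List.In c L -> close b be (iota (projT2 c.1)) c.2 del) ->
      close b be g B eps].
Proof.
move=> hb; have [mb mub b1 bM] := hb.
elim: (free_product_generated hG g) B eps => [|i a {}g _ ih] B eps mB eps0.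
  exists [::], 1; split=> // be [_ _ be1 _] _; exists set0.
  by split; rewrite ?pr0 ?ltW// => x _; rewrite be1 b1.
pose B' := b (iota a) @^-1` B.
have mB' : measurable B' by apply: measurable_preim.
have e20 : 0 < eps / 2 by rewrite divr_gt0.
have [L [del [del0 mL hL]]] := ih B' (eps / 2) mB' e20.
exists ((existT _ i a, B) :: L), (Num.min del (eps / 2)); split.
- by rewrite lt_min del0.
- by move=> c /= [<- //|/mL].
move=> be hbe hc; have [mbe mube _ beM] := hbe.
have h1 : close b be g B' (eps / 2).
  apply: hL => // c cL; apply: small_le (hc c (or_intror cL)).
  by rewrite ge_min lexx.
have h2 : close b be (iota a) B (eps / 2).
  apply: small_le (hc _ (or_introl erefl)).
  by rewrite ge_min lexx orbT.
have h3 := small_comp (mbe g) (mube g) h2.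
rewrite /close [eps]splitr; apply: small_imp (small_and h1 h3) => x [/= e1 e2].
by rewrite beM bM e2.
Qed.

Lemma In_flatten_map (T : eqType) (U : Type) (f : T -> seq U) (s : seq T) t u :
  t \in s -> List.In u (f t) -> List.In u (flatten [seq f t | t <- s]).
Proof.
elim: s => //= t' s ih; rewrite in_cons => /orP[/eqP ->|ts] h.
  by apply/List.in_app_iff; left.
by apply/List.in_app_iff; right; apply: ih.
Qed.

Lemma In_flatten_map_inv (T : eqType) (U : Type) (f : T -> seq U) (s : seq T) u :
  List.In u (flatten [seq f t | t <- s]) -> exists t, List.In u (f t).
Proof.
elim: s => //= t s ih /List.in_app_iff[h|/ih//]; by exists t.
Qed.

Lemma exists_common_bound (T : finType) (f : T -> R) : (forall t, 0 < f t) ->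
  exists2 del, 0 < del & forall t, del <= f t.
Proof.
move=> f0; suff [del del0 h] : exists2 del, 0 < del & forall t, t \in enum T -> del <= f t.
  by exists del => // t; apply: h; rewrite mem_enum.
elim: (enum T) => [|t s [del del0 h]]; first by exists 1.
exists (Num.min del (f t)); first by rewrite lt_min del0 f0.
move=> t'; rewrite in_cons => /orP[/eqP ->|/h]; first by rewrite ge_min lexx orbT.
by move=> h'; rewrite ge_min h'.
Qed.

Lemma close_reduction_family (b : G -> X -> X) (T : finType) (g : T -> G)
    (B : T -> set X) (eps : T -> R) :
  act mu b -> (forall t, measurable (B t)) -> (forall t, 0 < eps t) ->
  exists (L : seq ({i & A i} * set X)) (del : R), [/\ 0 < del,
    forall c, List.In c L -> measurable c.2 &
    forall be, act mu be ->
      (forall c, List.In c L -> close b be (iota (projT2 c.1)) c.2 del) ->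
      forall t, close b be (g t) (B t) (eps t)].
Proof.
move=> hb mB eps0.
have /choice[F hF] : forall t, exists Ld : seq ({i & A i} * set X) * R,
    [/\ 0 < Ld.2, forall c, List.In c Ld.1 -> measurable c.2 &
    forall be, act mu be ->
      (forall c, List.In c Ld.1 -> close b be (iota (projT2 c.1)) c.2 Ld.2) ->
      close b be (g t) (B t) (eps t)].
  move=> t; have [L [del [? ? ?]]] := close_reduction (g t) hb (mB t) (eps0 t).
  by exists (L, del).
have [del del0 hdel] : exists2 del, 0 < del & forall t, del <= (F t).2.
  by apply: exists_common_bound => t; case: (hF t).
exists (flatten [seq (F t).1 | t <- enum T]), del; split=> //.
  move=> c cL; have [t ct] := @In_flatten_map_inv _ _ (fun t => (F t).1) _ _ cL.
  by case: (hF t) => _ h _; apply: h.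
move=> be hbe hc t; case: (hF t) => _ _; apply=> // c cF.
apply: small_le (hdel t) _; apply: hc.
by apply: (@In_flatten_map _ _ (fun t => (F t).1) _ t) => //; rewrite mem_enum.
Qed.

Hypothesis hX : @standard_borel R d X.
Hypothesis hna : nonatomic mu.

Lemma finite_projection (L : seq ({i & A i} * set X)) i :
  exists K : seq (A i), forall c a, List.In c L -> c.1 = existT _ i a -> a \in K.
Proof.
elim: L => [|[[j a] B] L [K hK]]; first by exists [::].
have [ji|ji] := pselect (j = i).
  subst j; exists (a :: K) => c a' /= [<- /= h|cL /hK h].
    rewrite in_cons; apply/orP; left; apply/eqP.
    pose f (s : {i & A i}) : A i := match pselect (projT1 s = i) with
      | left e => eq_rect _ (fun k => gcar (A k)) (projT2 s) i e
      | right _ => gone (A i) end.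
    have fE c' : f (existT _ i c') = c'.
      rewrite /f /=; case: pselect => // e.
      by rewrite (Prop_irrelevance e erefl).
    by rewrite -(fE a) h fE.
  by rewrite in_cons h// orbT.
exists K => c a' /= [<- /= h|cL /hK]; last exact.
by case: ji; rewrite -[j]/(projT1 (existT (fun i => gcar (A i)) j a)) h.
Qed.

Lemma close_action (a b : G -> X -> X) (L : seq ({i & A i} * set X)) (eps : R) :
  act mu a -> ess_free mu a -> act mu b ->
  (forall c, List.In c L -> measurable c.2) -> 0 < eps ->
  exists be, [/\ act mu be,
    (exists T S : X -> X, mp_aut_pair mu T S /\
      forall x, [set y | exists g : G, y = be g x] =
                [set y | exists h : G, y = T (a h (S x))]) &
    forall c, List.In c L -> close b be (iota (projT2 c.1)) c.2 eps].
Proof.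
move=> ha fa hb mL eps0.
(* Below, [c0] is the default of [nth] and guarantees a relevant factor, which is needed to compare
   the frequencies of [Q] and [P] on [X]. *)
have [L0|[c0 c0L]] : L = [::] \/ exists c, List.In c L.
- by case: (L) => [|c ?]; [left|right; exists c; left].
- exists a; split=> //; last by rewrite L0.
  by exists id, id; split=> //; apply: mp_aut_pair_id.
have [ma mua a1 aM] := ha; have [mb mub b1 bM] := hb.
have [S hS] := exists_separating hX.
pose r := size L; pose cn (k : 'I_r) := List.nth k L c0.
have cnL k : List.In (cn k) L.
  by apply: List.nth_In; apply/ssrnat.ltP; rewrite -[List.length L]/(size L).
have Lcn c : List.In c L -> exists k, cn k = c.
  move=> /(List.In_nth _ _ c0) [k [/ssrnat.ltP kL <-]].
  by exists (Ordinal kL).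
have [k0 _] := Lcn _ c0L.
pose ix k := projT1 (cn k).1.
(* The bit [false] tells whether [x] lies in the set of the [k]-th constraint, the bit [true]
   whether its image under [b] does. *)
pose P x := [ffun kb : 'I_r * bool => `[< (cn kb.1).2
  (if kb.2 then b (iota (projT2 (cn kb.1).1)) x else x) >]].
have mP : dmeas P.
  apply: dmeas_ffun => -[k []] /=; apply: dmeas_bool; last by apply: mL.
  by apply: (measurable_preim (mb _)); apply: mL.
pose C := {ffun 'I_r * bool -> bool}.
(* Three errors add up: two colour mismatches, at a point and at its translate, and the failure of
   equivariance of [phi]. Each mismatch comes from two matchings, which lose at most [e2 + e2] per
   colour; [e2] makes either loss at most [e1 / 2]. *)
pose e1 := eps / 3; have e10 : 0 < e1 by rewrite divr_gt0.
pose e2 := e1 / (4 * #|C|.+1%:R).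
have C0 : 0 < #|C|.+1%:R :> R by rewrite ltr0n.
have e20 : 0 < e2 by rewrite divr_gt0// mulr_gt0.
have sumC (u : R) : 0 <= u <= e2 + e2 -> \sum_(j : C) u <= e1 / 2.
  move=> /andP[u0 ue]; rewrite sumr_const -[_ *+ _]mulr_natl.
  apply: (@le_trans _ _ (#|C|.+1%:R * (e2 + e2))).
    by apply: ler_pM => //; rewrite ler_nat.
  rewrite le_eqVlt; apply/orP; left; apply/eqP.
  by rewrite /e2; field; rewrite gt_eqF.
have [Q [mQ hQ]] := equidistributed_colouring (T := 'I_r)
  (a := fun k (g : A (ix k)) => a (iota g)) hS (fun k => (hA (ix k)).2)
  (fun k => act_comp_iota (ix k) ha) (fun k => ess_free_comp_iota (ix k) fa) mP e20.
have Q_P j : pr mu [set x | Q x = j] <= pr mu [set x | P x = j] + e2.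
  have := hQ k0 setT j measurableT (fun _ _ _ => Logic.I).
  by rewrite setIT prT mulr1 ler_norml; lra.
(* For an ergodic action the hypothesis of [matching] concerns only null and conull sets, where it
   reduces to the comparison [Q_P] of global frequencies. *)
have [eg [ga [eg_surj hga erg]]] := ergodic_action hX hna.
have [|T [Ti [hT _ sT]]] := matching hga eg_surj (s := Q) (t := P) (del := e2) mQ mP.
  move=> Z j mZ iZ.
  have mQZ : measurable ([set x | Q x = j] `&` Z).
    by apply: measurableI => //; apply: (mQ [set j]).
  have mPZ : measurable ([set x | P x = j] `&` Z).
    by apply: measurableI => //; apply: (mP [set j]).
  have [Z0|Z1] := erg Z mZ iZ.
    apply: (@le_trans _ _ 0); last by rewrite addr_ge0 ?pr_ge0 ?ltW.
    by rewrite -Z0; apply: le_pr => // x [].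
  have -> : pr mu ([set x | P x = j] `&` Z) = pr mu [set x | P x = j].
    rewrite [RHS](prID mu (mP [set j]) mZ); apply/esym/eqP.
    rewrite -subr_eq0 addrC addKr eq_le pr_ge0 andbT.
    have <- : pr mu (~` Z) = 0 by rewrite prC// Z1 subrr.
    apply: le_pr.
    - by apply: measurableD => //; apply: (mP [set j]).
    - exact: measurableC.
    - by move=> x [].
  apply: le_trans (Q_P j); apply: le_pr => //; exact: (mQ [set j]).
have {}sT : small mu (e1 / 2) (fun x => Q x = P (T x)).
  by apply: small_le sT; apply: sumC; apply/andP; split; lra.
have /choice[RS hRS] : forall i, exists RS : (X -> X) * (X -> X),
    [/\ mp_aut_pair mu RS.1 RS.2,
      forall x, exists g : A i, RS.1 x = a (iota g) x &
      forall c (g : A i), List.In c L -> c.1 = existT _ i g ->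
        small mu eps (fun z => c.2 (T (RS.1 (a (iota g) z))) <->
                               c.2 (b (iota g) (T (RS.1 z))))].
  (* A factor without constraints keeps the identity; there may be infinitely many of these, whereas
     [Q] serves only the finitely many others. *)
  move=> i; have [[k ki]|nk] := pselect (exists k, ix k = i); last first.
    exists (id, id); split=> /=; first exact: mp_aut_pair_id.
      by move=> x; exists (gone (A i)); rewrite hom1.
    move=> c g /Lcn[k <-] e; case: nk; exists k.
    by rewrite /ix e.
  have [K hK] := finite_projection L i.
  have hai := act_comp_iota i ha; have hbi := act_comp_iota i hb.
  have [phi [mphi phi_eq phi_dist]] := approximate_factor K hS (hA i).1 (hA i).2
    hai (ess_free_comp_iota i fa) hbi mP e20.
  have [e [_ e_surj]] := countably_infinite_enum (hA i).2.
  have hQi : equidist mu P (fun g : A i => a (iota g)) e2 Q.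
    by have := hQ k; rewrite ki.
  have [|U [V [hU U_in sU]]] := matching hai e_surj (s := P \o phi) (t := Q)
      (del := e2 + e2) mphi mQ.
    move=> Z j mZ iZ; have := hQi Z j mZ iZ; have := phi_dist Z j mZ iZ.
    by rewrite !ler_norml; lra.
  have {}sU : small mu (e1 / 2) (fun x => (P \o phi) x = Q (U x)).
    by apply: small_le sU; apply: sumC; apply/andP; split; lra.
  exists (U, V); split=> //= c g cL cg.
  have gK : g \in K by apply: hK cL cg.
  have [k' ck'] := Lcn _ cL.
  have [mU _ _ _ muU] := hU.
  have sPU : small mu e1 (fun x => P (T (U x)) = P (phi x)).
    rewrite [e1]splitr; apply: small_imp (small_and sU (small_comp mU muU sT)).
    by move=> x [/= -> ->].
  have [mai muai _ _] := hai.
  have sPUg := small_comp (mai g) (muai g) sPU.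
  have sphi : small mu e1 (fun x => phi (a (iota g) x) = b (iota g) (phi x)).
    apply: small_le (phi_eq g gK); rewrite /e2 ler_pdivrMr ?mulr_gt0//.
    rewrite ler_peMr ?ltW//; have : 1 <= #|C|.+1%:R :> R by rewrite ler1n.
    by lra.
  have -> : eps = e1 + e1 + e1 by rewrite /e1; field.
  apply: small_imp (small_and (small_and sPU sPUg) sphi) => z [[h1 h2] h3].
  have PE x : P x (k', false) <-> c.2 x.
    by rewrite ffunE /= ck'; split=> /asboolP.
  have PT x : P x (k', true) <-> c.2 (b (iota g) x).
    by rewrite ffunE /= ck' cg; split=> /asboolP.
  (* The bit [false] of [P] is read at the translate and the bit [true] at [z]; replacing both by
     colours at values of [phi] reduces the claim to equivariance of [phi]. *)
  by rewrite -PE -PT h1 [P _](h2) PT -PE h3 PE.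
pose TU i := T \o (RS i).1; pose VS i := (RS i).2 \o Ti.
have hTU i : mp_aut_pair mu (TU i) (VS i).
  by apply: mp_aut_pair_comp => //; case: (hRS i).
pose phi i (g : A i) : autom_group mu := Autom (conj_pair (hTU i) (act_pair ha (iota g))).
have [|psi [psi_hom psi_iota _]] := hG.2 (autom_group mu) phi.
  move=> i g h; case: (hTU i) => _ _ K1 K2 _.
  apply: autom_eq; apply/funext => x /=; first by rewrite iota_hom aM K1.
  by rewrite iota_hom ginvM aM K1.
have hbe := act_of_hom psi_hom.
set be := (fun g => aut_fun (psi g)) in hbe.
have beE i (g : A i) x : be (iota g) x = T ((RS i).1 (a (iota g) ((RS i).2 (Ti x)))).
  by rewrite /be psi_iota.
have [_ _ TK TiK _] := hT.
exists be; split=> //; last first.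
  move=> c cL; case E : c.1 => [i g] /=.
  have [hi _ hclose] := hRS i.
  have := hclose c g cL E; have [_ mVS K1 K2 _] := hTU i.
  have [_ _ _ _ muVS] := mp_aut_pair_sym (hTU i).
  move=> /(small_comp mVS muVS); apply: small_imp => x /=.
  by rewrite beE -[(RS i).2 (Ti x)]/(VS i x) -[T ((RS i).1 (VS i x))]/(TU i (VS i x)) K2.
exists T, Ti; split=> // x; rewrite -(TiK x); set z := Ti x; rewrite TK.
have [_ _ be1 beM] := hbe.
have RSin i w : exists g : A i, (RS i).1 w = a (iota g) w by case: (hRS i).
have RSVin i w : exists g : A i, (RS i).2 w = a (iota g) w.
  have [[_ _ K1 K2 _] _ _] := hRS i; have [g hg] := RSin i ((RS i).2 w).
  exists (ginv g); rewrite K2 in hg.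
  by rewrite (homV (@iota_hom i)) {2}hg (actK ha).
apply/seteqP; split=> y /= [g ->] {y}.
  elim: (free_product_generated hG g) => [|i c {}g _ [h hh]].
    by exists (gone G); rewrite be1 a1.
  rewrite beM hh beE TK.
  have [c1 ->] := RSVin i (a h z); rewrite -aM.
  have [c2 ->] := RSin i (a (gmul (iota c) (iota c1)) (a h z)).
  by rewrite -!aM; eexists.
elim: (free_product_generated hG g) => [|i c {}g _ [h hh]].
  by exists (gone G); rewrite be1 a1.
rewrite aM; set w := a g z in hh *.
have [c1 hc1] := RSVin i w; have [c2 hc2] := RSVin i (a (iota c) w).
(* [c1] and [c2] describe the inverse of [R_i] at [w] and at its translate by [c], so this element
   of the factor leads from the first preimage to the second. *)
exists (gmul (iota (gmul (gmul c2 c) (ginv c1))) h).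
rewrite beM -hh beE TK hc1 -aM -!iota_hom -gmulA gmulV gmulr1.
rewrite iota_hom aM -hc2.
by have [[_ _ _ K2 _] _ _] := hRS i; rewrite K2.
Qed.

End Density.

Theorem theorem1p3
  (I : Type) (A : I -> group) (G : group) (iota : forall i, A i -> G)
  (hI : at_most_countable I)
  (hA : forall i, abelian_group (A i) /\ countably_infinite (A i))
  (hG : @free_product I A G iota)
  (R : realType) (d : measure_display) (X : measurableType d)
  (mu : probability X R)
  (hX : @standard_borel R d X) (hna : nonatomic mu)
  (alpha : G -> X -> X)
  (halpha : pmp_action mu alpha) (hfree : ess_free mu alpha) :
  dense_in_actions mu (OE_class mu alpha).
Proof.
move=> n g S eps m P hP [b [hb hbS]].
have [e e_surj] := free_product_countable hG hI (fun i => (hA i).2).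
have [a [ha [Na [mNa Na0 aE]]]] := exact_action e_surj halpha.
have [b' [hb' [Nb [mNb Nb0 bE]]]] := exact_action e_surj hb.
have fa : ess_free mu a.
  case: hfree => N [mN N0 hN]; exists (N `|` Na).
  have [mU U0] : null mu (N `|` Na) by apply: null_setU.
  split=> // x /not_orP[Nx Nax] h h1; rewrite aE//; exact: hN.
pose T := {k : 'I_n & 'I_(m k)}.
pose kt (t : T) : 'I_n := tag t; pose jt (t : T) : nat := tagged t.
have jtm t : (jt t < m (kt t))%N by rewrite /jt; apply: ltn_ord.
pose B t := P (kt t) (jt t).
have mB t : measurable (B t).
  by have [_ _ [mP _ _]] := hP _ (ltn_ord (kt t)); apply: mP.
have mimg (f : X -> X) t : mp_aut mu f -> measurable (f @` B t).
  by move=> [fi [_ mfi fK fiK _]]; rewrite (image_aut _ fK fiK); apply: measurable_preim.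
have mSd (f h : X -> X) t : mp_aut mu f -> mp_aut mu h ->
    measurable (symdiff (f @` B t) (h @` B t)).
  by move=> hf hh; apply: measurableU; apply: measurableD; apply: mimg.
pose D t := symdiff (b (g (kt t)) @` B t) (S (kt t) @` B t).
have mD t : measurable (D t).
  by apply: mSd; [case: hb|have [? _ _] := hP _ (ltn_ord (kt t))].
have Dlt t : pr mu (D t) < eps (kt t).
  by have := hbS _ (ltn_ord (kt t)) _ (jtm t); rewrite -/(D t) mu_pr// lte_fin.
(* Half of the slack left by [b] keeps the final inequality strict. *)
have eta0 t : 0 < (eps (kt t) - pr mu (D t)) / 2 by rewrite divr_gt0// subr_gt0.
(* The weak topology speaks of images of sets and [close] of preimages; passing to the inverse of
   [g] turns one into the other. *)
have [L [del [del0 mL hL]]] := close_reduction_family hG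
  (fun t => ginv (g (kt t))) hb' mB eta0.
have [be [hbe [U [V [hU orb]]] beL]] := close_action hA hG hX hna ha fa hb' mL del0.
have {}hL := hL be hbe beL.
exists be; split; last split; [split| |].
- exact: act_pmp.
- exists U, V; split=> //.
  have [_ mV _ _ _] := hU; have [_ _ _ _ muV] := mp_aut_pair_sym hU.
  exists (V @^-1` Na); split; [exact: measurable_preim|by rewrite muV|].
  move=> x NVx; rewrite orb; apply/seteqP; split=> y [h ->]; exists h.
    by rewrite aE.
  by rewrite aE.
- exact: act_pmp.
move=> k kn j jm.
pose t : T := existT _ (Ordinal kn) (Ordinal jm).
have [E [mE hE close]] := hL t.
have [bi hbi] : mp_aut mu (b (g k)) by case: hb.
have [_ mbi bK biK _] := hbi; have [_ _ _ _ mubi] := mp_aut_pair_sym hbi.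
have hbeaut : mp_aut mu (be (g k)).
  by exists (be (ginv (g k))); apply: act_pair.
have hSaut : mp_aut mu (S k) by have [? _ _] := hP _ kn.
have mW := mSd _ _ t hbeaut hSaut.
rewrite mu_pr// lte_fin.
apply: (@le_lt_trans _ _ (pr mu (D t) + pr mu E)); last first.
  by move: (Dlt t) hE; rewrite /=; lra.
(* [bi] is the pointwise inverse of [b (g k)]; it agrees at [x] with [b'] at the inverse element
   when [bi x] lies outside [Nb], where [b] and [b'] coincide. *)
have [mN N0] : null mu (bi @^-1` Nb) by split; [exact: measurable_preim|rewrite mubi].
have N0' : pr mu (bi @^-1` Nb) = 0 by apply/pr_null.
apply: (@le_trans _ _ (pr mu (D t `|` E `|` bi @^-1` Nb))).
  apply: le_pr => //; first by apply: measurableU => //; apply: measurableU.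
  move=> x Wx; have [Nx|Nx] := pselect (Nb (bi x)); first by right.
  have [Ex|/close cx] := pselect (E x); first by left; right.
  left; left.
  have beP : (be (g k) @` P k j) x <-> P k j (be (ginv (g k)) x).
    by rewrite (image_aut _ (actK hbe _) (actVK hbe _)).
  have bP : (b (g k) @` P k j) x <-> P k j (bi x).
    by rewrite (image_aut _ bK biK).
  have b'x : b' (ginv (g k)) x = bi x.
    by rewrite -{1}(biK x) -bE// (actK hb').
  have {}cx : P k j (be (ginv (g k)) x) <-> P k j (bi x) by rewrite -b'x.
  by move: Wx; rewrite /D /symdiff /B /= => -[[h1 h2]|[h1 h2]]; [left|right];
    split=> //; tauto.
apply: le_trans (prU_le mu _ mN) _; first exact: measurableU.
by rewrite N0' addr0; apply: prU_le.
Qed.
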